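(* Let $k$ be a field and let $H$ be a finite-dimensional quasitriangular Hopf algebra over $k$ with $R$-matrix $R$. Let $C=\sum C^{(1)}\otimes C^{(2)}\in H\otimes H$ be a $2$-cocycle for $H^*$ and let $R_C=(\tau C)\,R\,C^{-1}=\sum R_C^{(1)}\otimes R_C^{(2)}$. Then the $H$-module algebra ${}_CH^*=k\#_CH^*$ with $H$-action $h\rightharpoonup f=\sum f_{(1)}\langle f_{(2)},h\rangle$ is $(H,R)$-Azumaya if and only if the map $\theta\colon H^{*,op}\to H$ given by $\theta(f)=\sum R_C^{(1)}\langle f,R_C^{(2)}\rangle$ is an isomorphism.
   Context: $\tau$ is the flip on $H\otimes H$; Sweedler notation is used for coproducts. $R=\sum R^{(1)}\otimes R^{(2)}\in H\otimes H$ is an $R$-matrix: it is invertible, $(\Delta\otimes \mathrm{id})R=R_{13}R_{23}$, $(\mathrm{id}\otimes\Delta)R=R_{13}R_{12}$ and $\tau\Delta(h)\,R=R\,\Delta(h)$ for all $h\in H$. An element $C\in H\otimes H$ is viewed as a functional on $H^*\otimes H^*$ by $C(f\otimes g)=\sum\langle f,C^{(1)}\rangle\langle g,C^{(2)}\rangle$. It is a $2$-cocycle for $H^*$ if it is (convolution) invertible, $C(f\otimes 1)=C(1\otimes f)=\varepsilon(f)$, and $\sum C(g_{(1)}\otimes l_{(1)})C(f\otimes g_{(2)}l_{(2)})=\sum C(f_{(1)}\otimes g_{(1)})C(f_{(2)}g_{(2)}\otimes l)$ for all $f,g,l\in H^*$. The algebra ${}_CH^*$ is $H^*$ as a vector space,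 with product $f\cdot g=\sum C(f_{(1)}\otimes g_{(1)})f_{(2)}g_{(2)}$. $(H,R)$-Azumaya: let $A$ be a finite-dimensional left $H$-module algebra. Its opposite $\overline A$ is $A$ as an $H$-module, with product $a\circ b=\sum(R^{(2)}.b)(R^{(1)}.a)$. For two $H$-module algebras $A,B$, $A\#B$ is $A\otimes B$ with product $(a\#b)(c\#d)=\sum a(R^{(2)}.c)\#(R^{(1)}.b)d$. $A$ is $(H,R)$-Azumaya if the $H$-module algebra maps $F'\colon A\#\overline A\to End(A)$, $F'(a\#\bar b)(c)=\sum a(R^{(2)}.c)(R^{(1)}.b)$, and $G'\colon\overline A\#A\to End(A)^{op}$, $G'(\bar a\#b)(c)=\sum(R^{(2)}.a)(R^{(1)}.c)b$, are both isomorphisms (equivalently, bijective). *)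

(* Defs.v *)
From HB Require Import structures.
From mathcomp Require Import all_boot all_order all_algebra all_field.

Set Implicit Arguments.
Unset Strict Implicit.
Unset Printing Implicit Defensive.

Import GRing.Theory.
Local Open Scope ring_scope.

(* MathComp has no tensor product of vector spaces.  A tensor is encoded by   *)
(* its matrix of coefficients in the chosen bases [vbasis] of the factors;    *)
(* the lemmas [tensS_bilin], [tens_ind] and [sweedlerE] below are the         *)
(* universal property of this encoding.                                       *)

Section TensorSpace.
Variable k : fieldType.

Definition tens (U V : vectType k) := 'M[k]_(\dim {:U}, \dim {:V}).

HB.instance Definition _ (U V : vectType k) :=
  Vector.copy (tens U V) 'M[k]_(\dim {:U}, \dim {:V}).

Definition pure (U V : vectType k) (u : U) (v : V) : tens U V :=
  \matrix_(i, j) (coord (vbasis {:U}) i u * coord (vbasis {:V}) j v).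

(* The linear map on [tens U V] induced by a bilinear [f].  With the notation *)
(* [\sw_(a, b <- t) E] it is the Sweedler sum of E over t = sum a (x) b.      *)
Definition sweedler (U V : vectType k) (W : lmodType k) (f : U -> V -> W)
    (t : tens U V) : W :=
  \sum_i \sum_j t i j *: f (vbasis {:U})`_i (vbasis {:V})`_j.

Definition bilin (U V W : lmodType k) (f : U -> V -> W) : Prop :=
  (forall u, linear (f u)) /\ (forall v, linear (f^~ v)).

End TensorSpace.

Notation "u \ox v" := (pure u v)
  (at level 40, left associativity, format "u  \ox  v") : ring_scope.
Notation "\sw_ ( a , b <- t ) E" := (sweedler (fun a b => E) t)
  (at level 36, E at level 36, a name, b name, t at level 200,
   format "\sw_ ( a ,  b  <-  t )  E") : ring_scope.

Section TensorTheory.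
Variable k : fieldType.
Implicit Types (U V : vectType k) (W : lmodType k).

Lemma linfun_linE (U V : vectType k) (f : U -> V) : linear f -> linfun f =1 f.
Proof.
move=> lf u.
pose m := GRing.isSemilinear.Build k U V _ f (GRing.semilinear_linear lf).
pose ff : {linear U -> V} := HB.pack f m.
exact: (lfunE ff u).
Qed.

Lemma sweedler_linear U V W (f : U -> V -> W) : linear (sweedler f).
Proof.
move=> c s t; rewrite /sweedler scaler_sumr -big_split; apply: eq_bigr => i _ /=.
rewrite scaler_sumr -big_split; apply: eq_bigr => j _ /=.
by rewrite !mxE scalerDl scalerA.
Qed.
HB.instance Definition _ U V W (f : U -> V -> W) :=
  GRing.isSemilinear.Build k (tens U V) W _ (sweedler f)
    (GRing.semilinear_linear (sweedler_linear f)).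

Lemma eq_sweedler U V W (f g : U -> V -> W) t :
  (forall a b, f a b = g a b) -> sweedler f t = sweedler g t.
Proof.
by move=> e; apply: eq_bigr => i _; apply: eq_bigr => j _; rewrite e.
Qed.

Lemma linear0_ (U V : lmodType k) (f : U -> V) : linear f -> f 0 = 0.
Proof.
by move=> lf; move: (lf (-1) 0 0); rewrite scaler0 addr0 scaleN1r addNr.
Qed.

Lemma linear_sum_ (U V : lmodType k) (f : U -> V) (I : finType) (c : I -> k)
    (u : I -> U) :
  linear f -> f (\sum_i c i *: u i) = \sum_i c i *: f (u i).
Proof.
move=> lf; apply: (big_rec2 (fun x y => f x = y)); first exact: linear0_.
by move=> i x y _ <-; rewrite lf.
Qed.

Lemma sweedler_comp U V W (W' : lmodType k) (h : W -> W') (f : U -> V -> W) t :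
  linear h -> h (sweedler f t) = \sw_(a, b <- t) h (f a b).
Proof.
move=> lh; rewrite /sweedler.
under eq_bigr do rewrite -[\sum_j _]scale1r.
rewrite (linear_sum_ _ _ lh); apply: eq_bigr => i _; rewrite scale1r.
exact: linear_sum_.
Qed.

Lemma sweedlerD U V W (f g : U -> V -> W) c t :
  \sw_(a, b <- t) (c *: f a b + g a b) = c *: sweedler f t + sweedler g t.
Proof.
rewrite /sweedler scaler_sumr -big_split; apply: eq_bigr => i _ /=.
rewrite scaler_sumr -big_split; apply: eq_bigr => j _ /=.
by rewrite scalerDr !scalerA mulrC.
Qed.

Lemma tensS_bilin U V : bilin (@pure k U V).
Proof.
split=> [u c v v'|v c u u']; apply/matrixP => i j; rewrite !mxE linearP.
  by rewrite mulrDr mulrCA.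
by rewrite mulrDl mulrA.
Qed.

Lemma tensE U V (t : tens U V) : t = sweedler (@pure k U V) t.
Proof.
apply/matrixP => i j; rewrite summxE (bigD1 i) //= summxE (bigD1 j) //= !mxE.
have fU := basis_free (vbasisP {:U}); have fV := basis_free (vbasisP {:V}).
rewrite !coord_free // !eqxx !mulr1 !big1 ?addr0 // => a ai.
  rewrite summxE big1 // => b _.
  by rewrite !mxE !coord_free // (negbTE ai) mul0r mulr0.
by rewrite !mxE !coord_free // eqxx (negbTE ai) mul1r !mulr0.
Qed.

Lemma tens_ind U V (P : tens U V -> Prop) :
  P 0 -> (forall c s t, P s -> P t -> P (c *: s + t)) ->
  (forall u v, P (u \ox v)) -> forall t, P t.
Proof.
move=> P0 PD Pp t; rewrite (tensE t) /sweedler.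
have PDD s s' : P s -> P s' -> P (s + s').
  by move=> ps ps'; rewrite -[s]scale1r; apply: PD.
apply: (big_ind P) => // i _; apply: (big_ind P) => // j _.
by rewrite -[_ *: _]addr0; apply: PD.
Qed.

Lemma sweedlerE U V W (f : U -> V -> W) u v :
  bilin f -> sweedler f (u \ox v) = f u v.
Proof.
move=> [fr fl]; rewrite {2}(coord_vbasis (memvf u)) (linear_sum_ _ _ (fl v)).
apply: eq_bigr => i _.
rewrite {2}(coord_vbasis (memvf v)) (linear_sum_ _ _ (fr _)) scaler_sumr.
by apply: eq_bigr => j _; rewrite mxE scalerA.
Qed.

Lemma tens_ext U V W (f g : tens U V -> W) : linear f -> linear g ->
  (forall u v, f (u \ox v) = g (u \ox v)) -> f =1 g.
Proof.
move=> lf lg e; apply: tens_ind => // [|c s t es et].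
  by rewrite !linear0_.
by rewrite lf lg es et.
Qed.

End TensorTheory.

Section TensorAlgebra.
Variables (k : fieldType) (A B : falgType k).
Implicit Types x y z : tens A B.

Definition tens_one : tens A B := 1 \ox 1.
Definition tens_mul x y : tens A B :=
  \sw_(a, b <- x) \sw_(c, d <- y) ((a * c) \ox (b * d)).

Let pl (U V : vectType k) (v : V) : linear (fun u : U => u \ox v) :=
  (tensS_bilin U V).2 v.
Let pr (U V : vectType k) (u : U) : linear (fun v : V => u \ox v) :=
  (tensS_bilin U V).1 u.

Lemma tens_mul_bil2 (a : A) (b : B) :
  bilin (fun c d => (a * c) \ox (b * d)).
Proof.
by split=> u c v w; rewrite mulrDr -scalerAr ?pr ?pl.
Qed.

Lemma tens_mul_bil1 y :
  bilin (fun a b => \sw_(c, d <- y) ((a * c) \ox (b * d))).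
Proof.
by split=> u c v w; rewrite -sweedlerD; apply: eq_sweedler => a b;
  rewrite mulrDl -scalerAl ?pr ?pl.
Qed.

Lemma tens_mul_bilin : bilin tens_mul.
Proof.
split=> [x c y z|x]; last exact: sweedler_linear.
by rewrite /tens_mul -sweedlerD; apply: eq_sweedler => a b; rewrite linearP.
Qed.

Lemma tens_mulE a b c d : tens_mul (a \ox b) (c \ox d) = (a * c) \ox (b * d).
Proof.
rewrite /tens_mul sweedlerE; last exact: tens_mul_bil1.
by rewrite sweedlerE //; apply: tens_mul_bil2.
Qed.

Let mDr x : linear (tens_mul x) := tens_mul_bilin.1 x.
Let mDl x : linear (tens_mul^~ x) := tens_mul_bilin.2 x.

Lemma tens_mulA : associative tens_mul.
Proof.
move=> x y z; move: x; apply: tens_ext => [||a b].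
- by move=> c s t; rewrite mDl.
- by move=> c s t; rewrite !mDl.
move: y; apply: tens_ext => [||a' b'].
- by move=> c s t; rewrite mDl mDr.
- by move=> c s t; rewrite mDr mDl.
move: z; apply: tens_ext => [||a'' b''].
- by move=> c s t; rewrite !mDr.
- by move=> c s t; rewrite !mDr.
by rewrite !tens_mulE !mulrA.
Qed.

Lemma tens_mul1l : left_id tens_one tens_mul.
Proof.
move=> x; move: x; apply: tens_ext => // a b.
by rewrite tens_mulE !mul1r.
Qed.

Lemma tens_mul1r : right_id tens_one tens_mul.
Proof.
move=> x; move: x; apply: tens_ext => // a b.
by rewrite tens_mulE !mulr1.
Qed.

Lemma tens_mulDl : left_distributive tens_mul +%R.
Proof. by move=> x y z; have := mDl z 1 x y; rewrite /= !scale1r. Qed.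

Lemma tens_mulDr : right_distributive tens_mul +%R.
Proof. by move=> x y z; have := mDr x 1 y z; rewrite /= !scale1r. Qed.

Lemma coord_neq0 (U : vectType k) (u : U) :
  u != 0 -> exists i, coord (vbasis {:U}) i u != 0.
Proof.
move=> u0; apply/existsP; apply: contraNT u0 => /existsPn u0.
rewrite (coord_vbasis (memvf u)) big1 // => i _.
by move/negPn/eqP: (u0 i) => ->; rewrite scale0r.
Qed.

Lemma tens_one_neq0 : tens_one != 0.
Proof.
have [i ni] := coord_neq0 (oner_neq0 A); have [j nj] := coord_neq0 (oner_neq0 B).
apply/eqP => /matrixP/(_ i j); rewrite !mxE => /eqP.
by rewrite mulf_eq0 (negbTE ni) (negbTE nj).
Qed.

HB.instance Definition _ := GRing.Zmodule_isNzRing.Build (tens A B)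
  tens_mulA tens_mul1l tens_mul1r tens_mulDl tens_mulDr tens_one_neq0.

Lemma tens_scaleAl c x y : c *: (x * y) = (c *: x) * y.
Proof.
by have := mDl y c x 0; rewrite /= !addr0 (linear0_ (mDl y)) addr0 => /esym.
Qed.
HB.instance Definition _ := GRing.Lmodule_isLalgebra.Build k (tens A B)
  tens_scaleAl.

Lemma tens_scaleAr c x y : c *: (x * y) = x * (c *: y).
Proof.
by have := mDr x c y 0; rewrite /= !addr0 (linear0_ (mDr x)) addr0 => /esym.
Qed.
HB.instance Definition _ := GRing.Lalgebra_isAlgebra.Build k (tens A B)
  tens_scaleAr.
HB.instance Definition _ := Algebra_isFalgebra.Build k (tens A B).

Lemma pureM (a c : A) (b d : B) :
  (a \ox b) * (c \ox d) = (a * c) \ox (b * d) :> tens A B.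
Proof. exact: tens_mulE. Qed.

End TensorAlgebra.

Definition flip (k : fieldType) (U V : vectType k) (t : tens U V) : tens V U :=
  \sw_(a, b <- t) (b \ox a).

HB.mixin Record Falgebra_isHopf (k : fieldType) H of Falgebra k H := {
  coprod : {lrmorphism H -> tens H H};
  counit : {lrmorphism H -> k^o};
  antipode : {linear H -> H};
  coprodA : forall h : H,
    \sw_(a, b <- coprod h) \sw_(a1, a2 <- coprod a) (a1 \ox a2 \ox b)
    = \sw_(a, b <- coprod h) \sw_(b1, b2 <- coprod b) (a \ox b1 \ox b2);
  counitl : forall h : H, \sw_(a, b <- coprod h) ((counit a : k) *: b) = h;
  counitr : forall h : H, \sw_(a, b <- coprod h) ((counit b : k) *: a) = h;
  antipodel : forall h : H,
    \sw_(a, b <- coprod h) (antipode a * b) = (counit h : k)%:A;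
  antipoder : forall h : H,
    \sw_(a, b <- coprod h) (a * antipode b) = (counit h : k)%:A
}.

#[short(type="hopfAlgType")]
HB.structure Definition HopfAlgebra (k : fieldType) :=
  { H of Falgebra k H & Falgebra_isHopf k H }.

Section Dual.
Variables (k : fieldType).

Definition dual (H : vectType k) := 'Hom(H, k^o).
HB.instance Definition _ (H : vectType k) := Vector.on (dual H).

Definition ev (H : vectType k) (f : dual H) (h : H) : k^o := f h.

(* <f (x) g, t> *)
Definition tpair (H : vectType k) (t : tens H H) (f g : dual H) : k^o :=
  \sw_(a, b <- t) (ev f a * ev g b).

(* The image of f o mult under (H (x) H)^* = H^* (x) H^*, written in a basis  *)
(* of H and its dual basis; see [dual_coprodE].                               *)
Definition dual_coprod (H : falgType k) (f : dual H) : tens (dual H) (dual H) :=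
  let e := vbasis {:H} in
  let e' i : dual H := linfun (coord e i : H -> k^o) in
  \sum_(i < \dim {:H}) \sum_(j < \dim {:H})
    (ev f (e`_i * e`_j) : k) *: (e' i \ox e' j).

End Dual.

Section DualTheory.
Variables (k : fieldType) (H : falgType k).
Implicit Types (f g l : dual H) (s t : tens H H).

Lemma tpair_linear f g : linear (fun t => tpair t f g).
Proof. by move=> c s t; rewrite /tpair linearP. Qed.

Lemma ev_linear f : linear (ev f).
Proof. exact: linearP. Qed.

Lemma ev_linearl h : linear (fun f : dual H => ev f h).
Proof. by move=> c f g; rewrite /ev !lfunE /= !lfunE. Qed.

Lemma evZ c f h : ev (c *: f) h = c *: ev f h.
Proof. by rewrite /ev scale_lfunE. Qed.

Lemma mul_bil (U V : lmodType k) (F : U -> k^o) (G : V -> k^o) :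
  linear F -> linear G -> bilin (fun a b => F a * G b).
Proof.
move=> lF lG; split=> u c v w.
  by rewrite lG mulrDr scalerAr.
by rewrite lF mulrDl scalerAl.
Qed.

Lemma tpairE a b f g : tpair (a \ox b) f g = ev f a * ev g b.
Proof. by rewrite /tpair sweedlerE //; apply: mul_bil; apply: ev_linear. Qed.

Lemma dual_coprodE f a b :
  \sw_(f1, f2 <- dual_coprod f) (ev f1 a * ev f2 b) = ev f (a * b).
Proof.
have bl : bilin (fun f1 f2 : dual H => ev f1 a * ev f2 b).
  by apply: mul_bil; apply: ev_linearl.
have lc i : linear (coord (vbasis {:H}) i : H -> k^o).
  by move=> c u v; rewrite linearP.
rewrite /dual_coprod linear_sum /ev.
rewrite [in RHS](coord_vbasis (memvf a)) mulr_suml linear_sum.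
apply: eq_bigr => i _; rewrite linear_sum -scalerAl linearZ_LR /=.
rewrite [in RHS](coord_vbasis (memvf b)) mulr_sumr linear_sum scaler_sumr.
apply: eq_bigr => j _; rewrite linearZ_LR /= sweedlerE // -scalerAr linearZ_LR /=.
rewrite /ev !linfun_linE //.
by congr (_ *: _); rewrite [in RHS]linearZ_LR; apply: mulrC.
Qed.


Lemma dual_coprodE2 f g s t :
  \sw_(f1, f2 <- dual_coprod f) \sw_(g1, g2 <- dual_coprod g)
     (tpair s f1 g1 * tpair t f2 g2) = tpair (s * t) f g.
Proof.
move: s; apply: tens_ext => [c u v|c u v|a b].
- rewrite -sweedlerD; apply: eq_sweedler => f1 f2.
  rewrite -sweedlerD; apply: eq_sweedler => g1 g2.
  by rewrite tpair_linear mulrDl scalerAl.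
- by rewrite mulrDl -scalerAl tpair_linear.
move: t; apply: tens_ext => [c u v|c u v|a' b'].
- rewrite -sweedlerD; apply: eq_sweedler => f1 f2.
  rewrite -sweedlerD; apply: eq_sweedler => g1 g2.
  by rewrite tpair_linear mulrDr scalerAr.
- by rewrite mulrDr -scalerAr tpair_linear.
rewrite pureM tpairE -(dual_coprodE f) -(dual_coprodE g).
rewrite (sweedler_comp (h := fun x => x * _)); last first.
  by move=> c u v; rewrite mulrDl scalerAl.
apply: eq_sweedler => f1 f2.
rewrite (sweedler_comp (h := fun x => _ * x)); last first.
  by move=> c u v; rewrite mulrDr scalerAr.
by apply: eq_sweedler => g1 g2; rewrite !tpairE mulrACA.
Qed.

Lemma tpair_inj s t : (forall f g, tpair s f g = tpair t f g) -> s = t.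
Proof.
have lc i : linear (coord (vbasis {:H}) i : H -> k^o).
  by move=> c u v; rewrite linearP.
pose e' i : dual H := linfun (coord (vbasis {:H}) i : H -> k^o).
have te u i j : tpair u (e' i) (e' j) = u i j.
  move: u; apply: tens_ext => [c u v|c u v|a b]; first exact: tpair_linear.
    by rewrite !mxE.
  by rewrite tpairE /ev !linfun_linE // mxE.
by move=> e; apply/matrixP => i j; rewrite -!te e.
Qed.

End DualTheory.

(* [dual H] is an algebra under the convolution product [dual_mul], with unit *)
(* the counit of H.                                                           *)

Section DualAlgebra.
Variables (k : fieldType) (H : hopfAlgType k).
Implicit Types (f g l : dual H) (s t : tens H H).
Notation H3 := (tens (tens H H) H).

Definition dual_one : dual H := linfun (counit : H -> k^o).
Definition dual_mul f g : dual H := linfun (fun h => tpair (coprod h) f g).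

(* On H^* = Hom(H, k) the product twisted by C is f . g = (f (x) g)(C Delta); *)
(* the Sweedler form on H^* is [twdual_mul], and [twdual_mulC] compares both. *)
Definition dual_mulC (C : tens H H) f g : dual H := linfun (fun h => tpair (C * coprod h) f g).

Lemma dual_mulCE C f g h : ev (dual_mulC C f g) h = tpair (C * coprod h) f g.
Proof.
rewrite /ev linfun_linE // => c u v.
by rewrite linearP mulrDr -scalerAr tpair_linear.
Qed.

Lemma dual_oneE h : ev dual_one h = counit h.
Proof. by rewrite /ev linfun_linE // => c u v; rewrite linearP. Qed.

Lemma dual_mulE f g h :
  ev (dual_mul f g) h = \sw_(a, b <- coprod h) (ev f a * ev g b).
Proof. by rewrite /ev linfun_linE // => c u v; rewrite linearP tpair_linear. Qed.

Definition ev3 f g l (t : H3) : k^o := \sw_(s, c <- t) (tpair s f g * ev l c).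

Lemma ev3_linear f g l : linear (ev3 f g l).
Proof. exact: sweedler_linear. Qed.

Lemma ev3E f g l s c : ev3 f g l (s \ox c) = tpair s f g * ev l c.
Proof.
by rewrite /ev3 sweedlerE //; apply: mul_bil; [apply: tpair_linear|apply: ev_linear].
Qed.

Definition pure3 (a : H) t : H3 := \sw_(b1, b2 <- t) (a \ox b1 \ox b2).
Definition coprod_id t : H3 := \sw_(a, b <- t) (coprod a \ox b).
Definition id_coprod t : H3 := \sw_(a, b <- t) (pure3 a (coprod b)).

Lemma pureDl (U V : vectType k) (v : V) : linear (fun u : U => u \ox v).
Proof. exact: (tensS_bilin U V).2. Qed.
Lemma pureDr (U V : vectType k) (u : U) : linear (fun v : V => u \ox v).
Proof. exact: (tensS_bilin U V).1. Qed.

Lemma pure3_linear a : linear (pure3 a).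
Proof. exact: sweedler_linear. Qed.
Lemma pure3_linearl t : linear (pure3^~ t).
Proof.
move=> c a a'; rewrite /pure3 -sweedlerD; apply: eq_sweedler => b1 b2.
by rewrite !pureDl.
Qed.
Lemma pure3E a b c : pure3 a (b \ox c) = a \ox b \ox c.
Proof.
rewrite /pure3 sweedlerE //; split=> [u d v w|u d v w]; first exact: pureDr.
by rewrite pureDr pureDl.
Qed.
Lemma pure3M a b s t : pure3 (a * b) (s * t) = pure3 a s * pure3 b t.
Proof.
move: s; apply: tens_ext => [c u v|c u v|a1 b1].
- by rewrite mulrDl -scalerAl pure3_linear.
- by rewrite pure3_linear mulrDl -scalerAl.
move: t; apply: tens_ext => [c u v|c u v|a2 b2].
- by rewrite mulrDr -scalerAr pure3_linear.
- by rewrite pure3_linear mulrDr -scalerAr.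
by rewrite pureM !pure3E !pureM.
Qed.

Lemma coprod_id_linear : linear coprod_id. Proof. exact: sweedler_linear. Qed.
Lemma id_coprod_linear : linear id_coprod. Proof. exact: sweedler_linear. Qed.
Lemma coprod_idE a b : coprod_id (a \ox b) = coprod a \ox b.
Proof.
rewrite /coprod_id sweedlerE //; split=> [u d v w|u d v w]; first exact: pureDr.
by rewrite linearP pureDl.
Qed.
Lemma id_coprodE a b : id_coprod (a \ox b) = pure3 a (coprod b).
Proof.
rewrite /id_coprod sweedlerE //; split=> [u d v w|u d v w]; last exact: pure3_linearl.
by rewrite linearP pure3_linear.
Qed.
Lemma coprod_idM s t : coprod_id (s * t) = coprod_id s * coprod_id t.
Proof.
move: s; apply: tens_ext => [c u v|c u v|a1 b1].
- by rewrite mulrDl -scalerAl coprod_id_linear.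
- by rewrite coprod_id_linear mulrDl -scalerAl.
move: t; apply: tens_ext => [c u v|c u v|a2 b2].
- by rewrite mulrDr -scalerAr coprod_id_linear.
- by rewrite coprod_id_linear mulrDr -scalerAr.
by rewrite pureM !coprod_idE pureM rmorphM.
Qed.
Lemma id_coprodM s t : id_coprod (s * t) = id_coprod s * id_coprod t.
Proof.
move: s; apply: tens_ext => [c u v|c u v|a1 b1].
- by rewrite mulrDl -scalerAl id_coprod_linear.
- by rewrite id_coprod_linear mulrDl -scalerAl.
move: t; apply: tens_ext => [c u v|c u v|a2 b2].
- by rewrite mulrDr -scalerAr id_coprod_linear.
- by rewrite id_coprod_linear mulrDr -scalerAr.
by rewrite pureM !id_coprodE rmorphM pure3M.
Qed.

Lemma coprod_id_coprod h : coprod_id (coprod h) = id_coprod (coprod h).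
Proof.
rewrite /id_coprod /pure3 -coprodA; apply: eq_sweedler => a b.
rewrite {1}(tensE (coprod a)).
by rewrite (sweedler_comp (h := fun s => s \ox b)) //; apply: pureDl.
Qed.

Lemma tpair_coprod_id C t f g l :
  tpair t (dual_mulC C f g) l = ev3 f g l ((C \ox 1) * coprod_id t).
Proof.
move: t; apply: tens_ext => [c u v|c u v|a b]; first by rewrite tpair_linear.
  by rewrite coprod_id_linear mulrDr -scalerAr ev3_linear.
by rewrite tpairE coprod_idE pureM ev3E dual_mulCE mul1r.
Qed.

Lemma ev3_pure3 a t f g l : ev3 f g l (pure3 a t) = ev f a * tpair t g l.
Proof.
move: t; apply: tens_ext => [c u v|c u v|b d].
- by rewrite pure3_linear ev3_linear.
- by rewrite tpair_linear mulrDr scalerAr.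
by rewrite pure3E ev3E !tpairE mulrA.
Qed.

Lemma tpair_id_coprod C t f g l :
  tpair t f (dual_mulC C g l) = ev3 f g l (pure3 1 C * id_coprod t).
Proof.
move: t; apply: tens_ext => [c u v|c u v|a b]; first by rewrite tpair_linear.
  by rewrite id_coprod_linear mulrDr -scalerAr ev3_linear.
by rewrite tpairE id_coprodE -pure3M mul1r ev3_pure3 dual_mulCE.
Qed.

Definition cocycle_cond C := forall f g l,
  ev3 f g l ((C \ox 1) * coprod_id C) = ev3 f g l (pure3 1 C * id_coprod C).

Definition rtrans (a : H) f : dual H := linfun (fun x => ev f (x * a)).
Lemma rtransE a f x : ev (rtrans a f) x = ev f (x * a).
Proof.
by rewrite {1}/ev linfun_linE // => c u v; rewrite mulrDl -scalerAl ev_linear.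
Qed.

Lemma tpair_rtrans a b s f g :
  tpair (s * (a \ox b)) f g = tpair s (rtrans a f) (rtrans b g).
Proof.
move: s; apply: tens_ext => [c u v|c u v|a1 b1].
- by rewrite mulrDl -scalerAl tpair_linear.
- by rewrite tpair_linear.
by rewrite pureM !tpairE !rtransE.
Qed.

Lemma ev3_rtrans (a b c : H) (t : H3) f g l :
  ev3 f g l (t * (a \ox b \ox c)) = ev3 (rtrans a f) (rtrans b g) (rtrans c l) t.
Proof.
move: t; apply: tens_ext => [d u v|d u v|s e].
- by rewrite mulrDl -scalerAl ev3_linear.
- by rewrite ev3_linear.
by rewrite pureM !ev3E tpair_rtrans rtransE.
Qed.

Lemma ev3_mulr f g l (t t' x : H3) :
  (forall f g l, ev3 f g l t = ev3 f g l t') ->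
  ev3 f g l (t * x) = ev3 f g l (t' * x).
Proof.
move=> e; move: x; apply: tens_ext => [c u v|c u v|s c].
- by rewrite mulrDr -scalerAr ev3_linear.
- by rewrite mulrDr -scalerAr ev3_linear.
move: s; apply: tens_ext => [d u v|d u v|a b].
- by rewrite pureDl mulrDr -scalerAr ev3_linear.
- by rewrite pureDl mulrDr -scalerAr ev3_linear.
by rewrite !ev3_rtrans.
Qed.

Lemma dual_mulCA C : cocycle_cond C -> associative (dual_mulC C).
Proof.
move=> hC f g l; apply/lfunP => x.
rewrite -[LHS]/(ev _ x) -[RHS]/(ev _ x) !dual_mulCE tpair_coprod_id tpair_id_coprod.
by rewrite coprod_idM id_coprodM !mulrA coprod_id_coprod; apply/esym/ev3_mulr.
Qed.

Lemma dual_mulC1 f g : dual_mul f g = dual_mulC 1 f g.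
Proof.
by apply/lfunP => x; rewrite -[LHS]/(ev _ x) -[RHS]/(ev _ x) dual_mulCE mul1r dual_mulE.
Qed.

Lemma dual_mulA : associative dual_mul.
Proof.
have c1 : cocycle_cond 1.
  have e1 : 1 = 1 \ox 1 :> tens H H by [].
  by move=> f g l; congr ev3; rewrite {2 4}e1 coprod_idE id_coprodE !rmorph1 {3}e1 pure3E.
by move=> f g l; rewrite !dual_mulC1; apply: dual_mulCA.
Qed.

Lemma dual_mul1l : left_id dual_one dual_mul.
Proof.
move=> f; apply/lfunP => x; rewrite -[LHS]/(ev _ x) -[RHS]/(ev f x).
rewrite -[in RHS](counitl x) (sweedler_comp (h := ev f)); last exact: ev_linear.
rewrite dual_mulE; apply: eq_sweedler => a b.
by rewrite dual_oneE /ev linearZ_LR.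
Qed.

Lemma dual_mul1r : right_id dual_one dual_mul.
Proof.
move=> f; apply/lfunP => x; rewrite -[LHS]/(ev _ x) -[RHS]/(ev f x).
rewrite -[in RHS](counitr x) (sweedler_comp (h := ev f)); last exact: ev_linear.
rewrite dual_mulE; apply: eq_sweedler => a b.
by rewrite dual_oneE /ev linearZ_LR mulrC.
Qed.

Lemma tpair_lfl t g : linear (fun f : dual H => tpair t f g).
Proof.
move=> c f f'; rewrite /tpair -sweedlerD; apply: eq_sweedler => a b.
by rewrite ev_linearl mulrDl scalerAl.
Qed.
Lemma tpair_lfr t f : linear (fun g : dual H => tpair t f g).
Proof.
move=> c g g'; rewrite /tpair -sweedlerD; apply: eq_sweedler => a b.
by rewrite ev_linearl mulrDr scalerAr.
Qed.

Lemma tpair_Zl t c f g : tpair t (c *: f) g = c *: tpair t f g.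
Proof.
have := tpair_lfl t g c f 0.
by rewrite /= (linear0_ (tpair_lfl t g)) !addr0.
Qed.
Lemma tpair_Zr t c f g : tpair t f (c *: g) = c *: tpair t f g.
Proof.
have := tpair_lfr t f c g 0.
by rewrite /= (linear0_ (tpair_lfr t f)) !addr0.
Qed.

Lemma dual_mulC_linl C g : linear ((dual_mulC C)^~ g).
Proof.
move=> c f f'; apply/lfunP => x; rewrite !lfunE /= !lfunE /=.
by rewrite -![fun_of_lfun _ x]/(ev _ x) !dual_mulCE tpair_lfl.
Qed.
Lemma dual_mulC_linr C f : linear (dual_mulC C f).
Proof.
move=> c g g'; apply/lfunP => x; rewrite !lfunE /= !lfunE /=.
by rewrite -![fun_of_lfun _ x]/(ev _ x) !dual_mulCE tpair_lfr.
Qed.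
Lemma dual_mul_linl g : linear (dual_mul^~ g).
Proof. by move=> c f f'; rewrite !dual_mulC1 dual_mulC_linl. Qed.
Lemma dual_mul_linr f : linear (dual_mul f).
Proof. by move=> c g g'; rewrite !dual_mulC1 dual_mulC_linr. Qed.

Lemma dual_mulDl : left_distributive dual_mul +%R.
Proof. by move=> f g l; have := dual_mul_linl l 1 f g; rewrite /= !scale1r. Qed.
Lemma dual_mulDr : right_distributive dual_mul +%R.
Proof. by move=> l f g; have := dual_mul_linr l 1 f g; rewrite /= !scale1r. Qed.
Lemma dual_one_neq0 : dual_one != 0.
Proof.
apply/eqP => /lfunP/(_ 1); rewrite -[LHS]/(ev _ 1) dual_oneE rmorph1 lfunE.
by move/eqP; rewrite oner_eq0.
Qed.

HB.instance Definition _ := GRing.Zmodule_isNzRing.Build (dual H)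
  dual_mulA dual_mul1l dual_mul1r dual_mulDl dual_mulDr dual_one_neq0.

Lemma dual_scaleAl c f g : c *: (f * g) = (c *: f) * g.
Proof.
by have := dual_mul_linl g c f 0;
  rewrite /= !addr0 (linear0_ (dual_mul_linl g)) addr0 => /esym.
Qed.
HB.instance Definition _ := GRing.Lmodule_isLalgebra.Build k (dual H)
  dual_scaleAl.
Lemma dual_scaleAr c f g : c *: (f * g) = f * (c *: g).
Proof.
by have := dual_mul_linr f c g 0;
  rewrite /= !addr0 (linear0_ (dual_mul_linr f)) addr0 => /esym.
Qed.
HB.instance Definition _ := GRing.Lalgebra_isAlgebra.Build k (dual H)
  dual_scaleAr.
HB.instance Definition _ := Algebra_isFalgebra.Build k (dual H).

End DualAlgebra.

Definition leg12 (k : fieldType) (H : falgType k) (t : tens H H)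
  : tens (tens H H) H := \sw_(a, b <- t) (a \ox b \ox 1).
Definition leg13 (k : fieldType) (H : falgType k) (t : tens H H)
  : tens (tens H H) H := \sw_(a, b <- t) (a \ox 1 \ox b).
Definition leg23 (k : fieldType) (H : falgType k) (t : tens H H)
  : tens (tens H H) H := \sw_(a, b <- t) (1 \ox a \ox b).

Record is_Rmatrix (k : fieldType) (H : hopfAlgType k) (R : tens H H) : Prop := {
  Rmatrix_unit : R \is a GRing.unit;
  Rmatrix_coprodl : coprod_id R = leg13 R * leg23 R;
  Rmatrix_coprodr : id_coprod R = leg13 R * leg12 R;
  Rmatrix_intertwines : forall h : H, flip (coprod h) * R = R * coprod h
}.

(* An element C of H (x) H is the functional [tpair C] on H^* (x) H^*; the    *)
(* unit of H^* is the counit of H, and the counit of H^* is evaluation at 1.  *)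

Section Cocycle.
Variables (k : fieldType) (H : hopfAlgType k).
Implicit Types (C D : tens H H) (f g l : dual H).

Definition conv2 C D f g : k^o :=
  \sw_(f1, f2 <- dual_coprod f) \sw_(g1, g2 <- dual_coprod g)
    (tpair C f1 g1 * tpair D f2 g2).

Definition conv_invertible C : Prop :=
  exists D, (forall f g, conv2 C D f g = ev f 1 * ev g 1)
         /\ (forall f g, conv2 D C f g = ev f 1 * ev g 1).

Record is_2cocycle C : Prop := {
  cocycle_inv : conv_invertible C;
  cocycle_1r : forall f, tpair C f 1 = ev f 1;
  cocycle_1l : forall f, tpair C 1 f = ev f 1;
  cocycleE : forall f g l,
    \sw_(g1, g2 <- dual_coprod g) \sw_(l1, l2 <- dual_coprod l)
      (tpair C g1 l1 * tpair C f (g2 * l2))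
    = \sw_(f1, f2 <- dual_coprod f) \sw_(g1, g2 <- dual_coprod g)
      (tpair C f1 g1 * tpair C (f2 * g2) l)
}.

Lemma conv2E C D f g : conv2 C D f g = tpair (C * D) f g.
Proof. exact: dual_coprodE2. Qed.

Lemma conv_invertible_unit C : conv_invertible C -> C \is a GRing.unit.
Proof.
have t1 f g : ev f 1 * ev g 1 = tpair 1 f g by rewrite tpairE.
case=> D [CD DC]; apply/unitrP; exists D.
by split; apply: tpair_inj => f g; rewrite -conv2E ?CD ?DC t1.
Qed.

End Cocycle.

HB.mixin Record isHModuleAlgebra (k : fieldType) (H : hopfAlgType k) A
    of Falgebra k A := {
  hact : H -> A -> A;
  hact_bilin : bilin hact;
  hact1 : forall a : A, hact 1 a = a;
  hactM : forall (g h : H) (a : A), hact (g * h) a = hact g (hact h a);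
  hact_mul : forall (h : H) (a b : A),
    hact h (a * b) = \sw_(h1, h2 <- coprod h) (hact h1 a * hact h2 b);
  hact_one : forall h : H, hact h 1 = (counit h : k)%:A
}.

#[short(type="hmodAlgType")]
HB.structure Definition HModuleAlgebra (k : fieldType) (H : hopfAlgType k) :=
  { A of Falgebra k A & isHModuleAlgebra k H A }.

(* The algebra _C H^*; its unit is that of H^*. *)

Section TwistedDual.
Variables (k : fieldType) (H : hopfAlgType k).
Implicit Types (f g l : dual H).

Definition twdual (C : tens H H) (hC : is_2cocycle C) := 'Hom(H, k^o).

Variables (C : tens H H) (hC : is_2cocycle C).

HB.instance Definition _ := Vector.on (twdual hC).

Definition twdual_mul f g : dual H :=
  \sw_(f1, f2 <- dual_coprod f) \sw_(g1, g2 <- dual_coprod g)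
    ((tpair C f1 g1 : k) *: (f2 * g2)).

Lemma twdual_mulE f g h : ev (twdual_mul f g) h = tpair (C * coprod h) f g.
Proof.
rewrite /twdual_mul (sweedler_comp (h := fun u => ev u h)); last exact: ev_linearl.
rewrite -dual_coprodE2; apply: eq_sweedler => f1 f2.
rewrite (sweedler_comp (h := fun u => ev u h)); last exact: ev_linearl.
apply: eq_sweedler => g1 g2.
by rewrite evZ dual_mulE.
Qed.

Lemma twdual_mulC f g : twdual_mul f g = dual_mulC C f g.
Proof.
by apply/lfunP => x; rewrite -[LHS]/(ev _ x) -[RHS]/(ev _ x) dual_mulCE twdual_mulE.
Qed.

Lemma twdual_cocycle : cocycle_cond C.
Proof.
move=> f g l.
have pl t : \sw_(f1, f2 <- dual_coprod f) \sw_(g1, g2 <- dual_coprod g)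
      (tpair C f1 g1 * tpair t (f2 * g2) l) = ev3 f g l ((C \ox 1) * coprod_id t).
  move: t; apply: tens_ext => [c u v|c u v|a b].
  - rewrite -sweedlerD; apply: eq_sweedler => f1 f2.
    rewrite -sweedlerD; apply: eq_sweedler => g1 g2.
    by rewrite tpair_linear mulrDr scalerAr.
  - by rewrite coprod_id_linear mulrDr -scalerAr ev3_linear.
  rewrite coprod_idE pureM ev3E mul1r -dual_coprodE2.
  rewrite (sweedler_comp (h := fun x => x * _)); last first.
    by move=> c u v; rewrite mulrDl scalerAl.
  apply: eq_sweedler => f1 f2.
  rewrite (sweedler_comp (h := fun x => x * _)); last first.
    by move=> c u v; rewrite mulrDl scalerAl.
  by apply: eq_sweedler => g1 g2; rewrite tpairE dual_mulE mulrA.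
have pr t : \sw_(g1, g2 <- dual_coprod g) \sw_(l1, l2 <- dual_coprod l)
      (tpair C g1 l1 * tpair t f (g2 * l2)) = ev3 f g l (pure3 1 C * id_coprod t).
  move: t; apply: tens_ext => [c u v|c u v|a b].
  - rewrite -sweedlerD; apply: eq_sweedler => f1 f2.
    rewrite -sweedlerD; apply: eq_sweedler => g1 g2.
    by rewrite tpair_linear mulrDr scalerAr.
  - by rewrite id_coprod_linear mulrDr -scalerAr ev3_linear.
  rewrite id_coprodE -pure3M mul1r ev3_pure3 -dual_coprodE2.
  rewrite (sweedler_comp (h := fun x => _ * x)); last first.
    by move=> c u v; rewrite mulrDr scalerAr.
  apply: eq_sweedler => f1 f2.
  rewrite (sweedler_comp (h := fun x => _ * x)); last first.
    by move=> c u v; rewrite mulrDr scalerAr.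
  by apply: eq_sweedler => g1 g2; rewrite tpairE dual_mulE mulrCA.
by rewrite -pl -pr (cocycleE hC).
Qed.

Lemma twdual_mulA : associative twdual_mul.
Proof.
by move=> f g l; rewrite !twdual_mulC dual_mulCA //; apply: twdual_cocycle.
Qed.

Lemma twdual_mul1l : left_id 1 twdual_mul.
Proof.
move=> f; apply/lfunP => x; rewrite -[LHS]/(ev _ x) -[RHS]/(ev f x).
rewrite twdual_mulE -[in RHS](mul1r f) dual_mulE -/(tpair (coprod x) 1 f).
move: (coprod x); apply: tens_ext => [c u v|c u v|a b].
- by rewrite mulrDr -scalerAr tpair_linear.
- by rewrite tpair_linear.
have := cocycle_1l hC (rtrans b f); rewrite rtransE mul1r => e.
have r1 : rtrans a 1 = ev 1 a *: (1 : dual H).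
  apply/lfunP => y; rewrite -[LHS]/(ev _ y) rtransE lfunE /= -[fun_of_lfun _ y]/(ev _ y).
  by rewrite !dual_oneE rmorphM mulrC.
rewrite tpair_rtrans r1 tpair_Zl e tpairE.
by [].
Qed.

Lemma twdual_mul1r : right_id 1 twdual_mul.
Proof.
move=> f; apply/lfunP => x; rewrite -[LHS]/(ev _ x) -[RHS]/(ev f x).
rewrite twdual_mulE -[in RHS](mulr1 f) dual_mulE -/(tpair (coprod x) f 1).
move: (coprod x); apply: tens_ext => [c u v|c u v|a b].
- by rewrite mulrDr -scalerAr tpair_linear.
- by rewrite tpair_linear.
have := cocycle_1r hC (rtrans a f); rewrite rtransE mul1r => e.
have r1 : rtrans b 1 = ev 1 b *: (1 : dual H).
  apply/lfunP => y; rewrite -[LHS]/(ev _ y) rtransE lfunE /= -[fun_of_lfun _ y]/(ev _ y).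
  by rewrite !dual_oneE rmorphM mulrC.
rewrite tpair_rtrans r1 tpair_Zr e tpairE.
exact: mulrC.
Qed.

Lemma twdual_mul_linl g : linear (twdual_mul^~ g).
Proof. by move=> c f f'; rewrite !twdual_mulC dual_mulC_linl. Qed.
Lemma twdual_mul_linr f : linear (twdual_mul f).
Proof. by move=> c g g'; rewrite !twdual_mulC dual_mulC_linr. Qed.
Lemma twdual_mulDl : left_distributive twdual_mul +%R.
Proof. by move=> f g l; have := twdual_mul_linl l 1 f g; rewrite /= !scale1r. Qed.
Lemma twdual_mulDr : right_distributive twdual_mul +%R.
Proof. by move=> l f g; have := twdual_mul_linr l 1 f g; rewrite /= !scale1r. Qed.

Lemma twdual_mulZl c f g : c *: twdual_mul f g = twdual_mul (c *: f) g.
Proof.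
have := twdual_mul_linl g c f 0.
by rewrite /= (linear0_ (twdual_mul_linl g)) !addr0.
Qed.
Lemma twdual_mulZr c f g : c *: twdual_mul f g = twdual_mul f (c *: g).
Proof.
have := twdual_mul_linr f c g 0.
by rewrite /= (linear0_ (twdual_mul_linr f)) !addr0.
Qed.

HB.instance Definition _ := GRing.Zmodule_isNzRing.Build (twdual hC)
  twdual_mulA twdual_mul1l twdual_mul1r twdual_mulDl twdual_mulDr
  (dual_one_neq0 H).

Lemma twdual_scaleAl (c : k) (f g : twdual hC) : 
  c *: (f * g) = (c *: f : twdual hC) * g.
Proof. exact: twdual_mulZl. Qed.
HB.instance Definition _ := GRing.Lmodule_isLalgebra.Build k (twdual hC)
  twdual_scaleAl.
Lemma twdual_scaleAr (c : k) (f g : twdual hC) : 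
  c *: (f * g) = f * (c *: g : twdual hC).
Proof. exact: twdual_mulZr. Qed.
HB.instance Definition _ := GRing.Lalgebra_isAlgebra.Build k (twdual hC)
  twdual_scaleAr.
HB.instance Definition _ := Algebra_isFalgebra.Build k (twdual hC).

Definition twdual_act (h : H) (f : dual H) : dual H :=
  \sw_(f1, f2 <- dual_coprod f) ((ev f2 h : k) *: f1).

Lemma twdual_actE h f x : ev (twdual_act h f) x = ev f (x * h).
Proof.
rewrite /twdual_act (sweedler_comp (h := fun u => ev u x)); last exact: ev_linearl.
rewrite -dual_coprodE; apply: eq_sweedler => f1 f2.
by rewrite evZ mulrC.
Qed.

Lemma twdual_act_rtrans h f : twdual_act h f = rtrans h f.
Proof.
by apply/lfunP => x; rewrite -[LHS]/(ev _ x) -[RHS]/(ev _ x) twdual_actE rtransE.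
Qed.

Lemma twdual_act_bilin :
  bilin (twdual_act : H -> twdual hC -> twdual hC).
Proof.
split=> [h c f g|f c h h']; apply/lfunP => x; rewrite -[LHS]/(ev _ x);
  rewrite -[RHS]/(ev (_ *: (_ : dual H) + (_ : dual H)) x);
  rewrite ev_linearl /= !twdual_actE.
  by rewrite ev_linearl.
have e (y z : H) : x * (c *: y + z) = c *: (x * y) + x * z.
  by rewrite mulrDr scalerAr.
exact: etrans (congr1 (ev f) (e h h')) (ev_linear _ _ _ _).
Qed.

Lemma twdual_act1 (f : twdual hC) : twdual_act 1 f = f.
Proof.
by apply/lfunP => x; rewrite -[LHS]/(ev _ x) -[RHS]/(ev f x) twdual_actE mulr1.
Qed.

Lemma twdual_actM (g h : H) (f : twdual hC) :
  twdual_act (g * h) f = twdual_act g (twdual_act h f).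
Proof.
by apply/lfunP => x; rewrite -[LHS]/(ev _ x) -[RHS]/(ev _ x) !twdual_actE mulrA.
Qed.

Lemma tpair_mul_rtrans (s t : tens H H) f g :
  tpair (s * t) f g
  = \sw_(a, b <- t) tpair s (rtrans a f) (rtrans b g).
Proof.
move: t; apply: tens_ext => [c u v|c u v|a b].
- by rewrite mulrDr -scalerAr tpair_linear.
- by rewrite linearP.
rewrite tpair_rtrans sweedlerE //.
split=> u c v w /=; rewrite -!twdual_act_rtrans.
  by rewrite (twdual_act_bilin.2 g) tpair_lfr.
by rewrite (twdual_act_bilin.2 f) tpair_lfl.
Qed.

Lemma twdual_act_mul (h : H) (f g : twdual hC) :
  twdual_act h (f * g)
  = \sw_(h1, h2 <- coprod h)
      ((twdual_act h1 f : twdual hC) * (twdual_act h2 g : twdual hC)).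
Proof.
apply/lfunP => x; rewrite -[LHS]/(ev _ x) -[RHS]/(ev _ x) twdual_actE.
rewrite twdual_mulE (sweedler_comp (h := fun u => ev u x)); last exact: ev_linearl.
rewrite rmorphM mulrA.
rewrite tpair_mul_rtrans; apply: eq_sweedler => a b.
by rewrite twdual_mulE !twdual_act_rtrans.
Qed.

Lemma twdual_act_one (h : H) :
  twdual_act h (1 : twdual hC) = (counit h : k)%:A :> twdual hC.
Proof.
apply/lfunP => x; rewrite -[LHS]/(ev _ x) twdual_actE lfunE /=.
by rewrite -[fun_of_lfun _ x]/(ev _ x) !dual_oneE rmorphM mulrC.
Qed.

HB.instance Definition _ := isHModuleAlgebra.Build k H (twdual hC)
  twdual_act_bilin twdual_act1 twdual_actM twdual_act_mul twdual_act_one.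

Lemma twdual_prodE (f g : twdual hC) : f * g = twdual_mul f g.
Proof. by []. Qed.

Lemma twdual_hactE (h : H) (f : twdual hC) : hact h f = twdual_act h f.
Proof. by []. Qed.

End TwistedDual.

(* The maps F' and G' are defined on the space A (x) A underlying both        *)
(* A # A-bar and A-bar # A, with values in the space 'End(A) underlying both  *)
(* End(A) and End(A)^op.  As they are H-module algebra maps, they are         *)
(* isomorphisms if and only if they are bijective.                            *)

Section Azumaya.
Variables (k : fieldType) (H : hopfAlgType k) (R : tens H H).
Variable A : hmodAlgType H.
Implicit Types (a b c : A) (x : tens A A).

Definition azumayaF x : 'End(A) := linfun (fun c : A =>
  \sw_(a, b <- x) \sw_(r1, r2 <- R) (a * hact r2 c * hact r1 b)).

Definition azumayaG x : 'End(A) := linfun (fun c : A =>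
  \sw_(a, b <- x) \sw_(r1, r2 <- R) (hact r2 a * hact r1 c * b)).

Lemma azumayaFE x c : azumayaF x c =
  \sw_(a, b <- x) \sw_(r1, r2 <- R) (a * hact r2 c * hact r1 b).
Proof.
rewrite linfun_linE // => d u v; rewrite -sweedlerD; apply: eq_sweedler => a b.
rewrite -sweedlerD; apply: eq_sweedler => r1 r2.
by rewrite hact_bilin.1 mulrDr mulrDl -scalerAr -scalerAl.
Qed.

Lemma azumayaGE x c : azumayaG x c =
  \sw_(a, b <- x) \sw_(r1, r2 <- R) (hact r2 a * hact r1 c * b).
Proof.
rewrite linfun_linE // => d u v; rewrite -sweedlerD; apply: eq_sweedler => a b.
rewrite -sweedlerD; apply: eq_sweedler => r1 r2.
by rewrite hact_bilin.1 mulrDr mulrDl -scalerAr -scalerAl.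
Qed.

Definition azumaya : Prop := bijective azumayaF /\ bijective azumayaG.

End Azumaya.

(* The ring inverse is total; C is a unit of H (x) H when it is a 2-cocycle,  *)
(* by [conv_invertible_unit].                                                 *)
Definition twistR (k : fieldType) (H : hopfAlgType k) (C R : tens H H) :
  tens H H := flip C * R * C^-1.

(* [^c] is the opposite ring.  With T = R_C, theta is multiplicative for the  *)
(* product of H^* dual to the twisted coproduct C Delta C^-1, which is the    *)
(* convolution product only when C commutes with the image of Delta: as a map *)
(* out of (H^* )^op it is considered only as a linear map.                    *)
Definition theta (k : fieldType) (H : hopfAlgType k) (T : tens H H)
    (f : (dual H)^c) : H :=
  \sw_(r1, r2 <- T) ((ev (f : dual H) r2 : k) *: r1).

(* Main.v *)
Require Import Defs.
From HB Require Import structures.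
From mathcomp Require Import all_boot all_order all_algebra all_field.

Set Implicit Arguments.
Unset Strict Implicit.
Unset Printing Implicit Defensive.

Import GRing.Theory.
Local Open Scope ring_scope.

(** Write A for the algebra [_C H^*], [R_C = (tau C) R C^-1], and D for the
    inverse of C. The product of A is [(f g)(x) = (f (x) g)(C Delta(x))], and H
    acts by right translation of the argument. Since
    [Delta(y) R21 = R21 Delta^op(y)], the braided product [sum (R2.c)(R1.g)] of
    A is [sum (g s1)(c s2)], where [R_C = sum s1 (x) s2] and [(g s)(x) = g(s x)]
    ([twdual_braiding]). Regrouping by associativity, the value of
    [F'(f (x) g)(c)] at [x] is the pairing of [f (x) g] with the element
      [sum (1 (x) theta(w2.c)) C Delta(w1)],   [C Delta(x) = sum w1 (x) w2],
    of H (x) H ([azumayaF_transpose]). Thus the transpose of [F'] is a composite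
    of three maps: [c (x) x |-> sum w1 (x) w2.c], then [id (x) theta], then
    [u (x) h |-> (1 (x) h) C Delta(u)]. The first and the last do not involve R
    and are bijective, so that [F'] is bijective if and only if [theta] is.
    Likewise the transpose of [G'] consists of the transpose of [theta] between
    two bijective maps ([azumayaG_transpose]). All spaces are finite
    dimensional, so that injective, surjective and bijective agree.

    There remains the bijectivity of four Galois-type maps of H (x) H, sending
    [x (x) y] to [C Delta(x) (1 (x) y)], [C Delta(x) (y (x) 1)],
    [(1 (x) y) C Delta(x)] and [(y (x) 1) C Delta(x)]. In the first two, C is
    only an invertible factor on the left, and the antipode S gives an inverse.
    In the last two, C stands in the middle, and the cocycle identity is needed:
    contracted with S, it shows that [Q = sum C1 S(C2)] is invertible and gives
    explicit left inverses ([twisted_galois_l_inj], [twisted_galois_r_inj]). For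
    the second and the third map the left inverse involves an inverse of S. That
    S is bijective comes from the fourth map: R is itself a twist by the
    Yang-Baxter equation, and with R in the place of C the surjectivity of that
    map makes S surjective ([antipode_inj]). *)

(** * Linear maps given as plain functions *)

Section LinearTools.
Variable k : fieldType.

Lemma lin_0 (U V : lmodType k) : linear (fun _ : U => 0 : V).
Proof. by move=> c u v; rewrite scaler0 addr0. Qed.
Lemma lin_comp (U V W : lmodType k) (g : V -> W) (F : U -> V) :
  linear g -> linear F -> linear (fun x => g (F x)).
Proof. by move=> lg lF c u v; rewrite lF lg. Qed.
Lemma lin_map (U V W : lmodType k) (g : {linear V -> W}) (F : U -> V) :
  linear F -> linear (fun x => g (F x)).
Proof. by move=> lF c u v; rewrite lF linearP. Qed.
Lemma lin_mulr (U : lmodType k) (A : falgType k) (F : U -> A) (a : A) :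
  linear F -> linear (fun x => F x * a).
Proof. by move=> lF c u v; rewrite lF mulrDl -scalerAl. Qed.
Lemma lin_mull (U : lmodType k) (A : falgType k) (F : U -> A) (a : A) :
  linear F -> linear (fun x => a * F x).
Proof. by move=> lF c u v; rewrite lF mulrDr -scalerAr. Qed.
Lemma lin_purel (U : lmodType k) (V W : vectType k) (F : U -> V) (w : W) :
  linear F -> linear (fun x => F x \ox w).
Proof. by move=> lF c u v; rewrite lF pureDl. Qed.
Lemma lin_purer (U : lmodType k) (V W : vectType k) (F : U -> V) (w : W) :
  linear F -> linear (fun x => w \ox F x).
Proof. by move=> lF c u v; rewrite lF pureDr. Qed.
Lemma lin_sw (U W : lmodType k) (A B : vectType k) (g : A -> B -> W)
  (F : U -> tens A B) : linear F -> linear (fun x => sweedler g (F x)).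
Proof. by move=> lF c u v; rewrite lF linearP. Qed.
Lemma lin_in_sw (U W : lmodType k) (A B : vectType k) (G : U -> A -> B -> W) t :
  (forall a b, linear (fun x => G x a b)) ->
  linear (fun x => sweedler (G x) t).
Proof.
move=> lG c u v; rewrite -sweedlerD; apply: eq_sweedler => a b; exact: lG.
Qed.
Lemma lin_scaler (U V : lmodType k) (F : U -> V) (a : k) :
  linear F -> linear (fun x => a *: F x).
Proof. by move=> lF c u v; rewrite lF scalerDr !scalerA mulrC. Qed.
Lemma lin_scalel (U V : lmodType k) (F : U -> k^o) (a : V) :
  linear F -> linear (fun x => (F x : k) *: a).
Proof. by move=> lF c u v; rewrite lF scalerDl -scalerA. Qed.

Lemma inj_linear (U V : lmodType k) (f : U -> V) :
  linear f -> (forall u, f u = 0 -> u = 0) -> injective f.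
Proof.
move=> lf f0 u v e; apply/eqP; rewrite -subr_eq0 -scaleN1r addrC; apply/eqP.
by apply: f0; rewrite lf e scaleN1r addNr.
Qed.

Lemma inj_linear_retract (U V : vectType k) (f : U -> V) :
  linear f -> injective f -> exists g : 'Hom(V, U), cancel f g.
Proof.
move=> lf fi; pose F := linfun f.
have FE : F =1 f by apply: linfun_linE.
exists (F^-1)%VF => u; rewrite -FE; apply: lker0_lfunK.
by apply/lker0P => v w; rewrite !FE; apply: fi.
Qed.

Lemma inj_linear_bij (U V : vectType k) (f : U -> V) :
  linear f -> \dim {:U} = \dim {:V} -> injective f -> bijective f.
Proof.
move=> lf d fi; pose F := linfun f.
have FE : F =1 f by apply: linfun_linE.
have F0 : lker F == 0%VS by apply/lker0P => u v; rewrite !FE; apply: fi.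
have Ff : limg F = fullv.
  apply/eqP; rewrite eqEdim subvf limg_dim_eq; first by rewrite /= d leqnn.
  by rewrite (eqP F0) capv0.
exists (F^-1)%VF => u; first by rewrite -FE lker0_lfunK.
by rewrite -FE limg_lfunVK // Ff memvf.
Qed.

Lemma surj_linear_inj (U V : vectType k) (f : U -> V) :
  linear f -> \dim {:U} = \dim {:V} -> (forall v, exists u, f u = v) ->
  injective f.
Proof.
move=> lf d fs; pose F := linfun f.
have FE : F =1 f by apply: linfun_linE.
suff /lker0P F0 : lker F == 0%VS by move=> u v; rewrite -!FE => /F0.
have Ff : limg F = fullv.
  apply/vspaceP => v; rewrite memvf; have [u <-] := fs v.
  by rewrite -FE memv_img ?memvf.
have := limg_ker_dim F fullv; rewrite Ff capfv d => /eqP.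
by rewrite -[X in _ == X]add0n eqn_add2r dimv_eq0.
Qed.

Lemma pure_scale (U V : vectType k) (u : U) (v : V) (c : k) :
  (c *: u) \ox v = c *: (u \ox v).
Proof. by rewrite -[c *: u]addr0 pureDl; rewrite (linear0_ (pureDl v)) addr0. Qed.
Lemma pure_scaler (U V : vectType k) (u : U) (v : V) (c : k) :
  u \ox (c *: v) = c *: (u \ox v).
Proof. by rewrite -[c *: v]addr0 pureDr; rewrite (linear0_ (pureDr u)) addr0. Qed.

Lemma dim_tens (U V : vectType k) :
  \dim {:tens U V} = (\dim {:U} * \dim {:V})%N.
Proof. by rewrite [LHS]dimvf. Qed.
Lemma dim_hom (U V : vectType k) :
  \dim {:'Hom(U, V)} = (\dim {:U} * \dim {:V})%N.
Proof. by rewrite !dimvf. Qed.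
Lemma dim_dual (U : vectType k) : \dim {:dual U} = \dim {:U}.
Proof. by rewrite [LHS]dim_hom [\dim {: k^o}]dimvf muln1. Qed.

End LinearTools.

(** The Sweedler expressions below are bare functions rather than bundled linear
    maps, so that linearity in one variable is found by recursion on the shape
    of the expression. *)
Ltac lin := cbv beta; match goal with
 | |- GRing.linear_for _ _ => solve [done | exact: linearP]
 | |- GRing.linear_for _ (fun x => @?F x * ?a) => apply: (@lin_mulr _ _ _ F a); lin
 | |- GRing.linear_for _ (fun x => ?a * @?F x) => apply: (@lin_mull _ _ _ F a); lin
 | |- GRing.linear_for _ (fun x => @?F x \ox ?a) => apply: (@lin_purel _ _ _ _ F a); lin
 | |- GRing.linear_for _ (fun x => ?a \ox @?F x) => apply: (@lin_purer _ _ _ _ F a); lin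
 | |- GRing.linear_for _ (fun x => sweedler ?g (@?F x)) =>
     apply: (@lin_sw _ _ _ _ _ g F); lin
 | |- GRing.linear_for _ (fun x => sweedler (@?G x) ?t) =>
     apply: (@lin_in_sw _ _ _ _ _ G t); lin
 | |- GRing.linear_for _ (fun x => @?F x *: ?a) => apply: (@lin_scalel _ _ _ F a); lin
 | |- GRing.linear_for _ (fun x => ?a *: @?F x) => apply: (@lin_scaler _ _ _ F a); lin
 | |- GRing.linear_for _ (fun x => ?g (@?F x)) =>
     solve [apply: (@lin_map _ _ _ _ g F); lin | apply: (@lin_comp _ _ _ _ g F); lin]
 | |- GRing.linear_for _ (GRing.mul ?a) => apply: (@lin_mull _ _ _ (fun x => x) a); lin
 | |- GRing.linear_for _ (@pure _ _ _ ?a) => apply: (@lin_purer _ _ _ _ (fun x => x) a); lin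
 | |- bilin _ => split; lin
 | |- forall _, _ => intro; lin
 end.

(** * The antipode *)

Section Antipode.
Variables (k : fieldType) (H : hopfAlgType k).
Notation H2 := (tens H H).
Notation H3 := (tens (tens H H) H).
Notation S := (@antipode k H).
Implicit Types (a b c x y u v : H) (s t : H2) (w : H3).

(** A two-variable identity such as [sum a1 S(a2) = eps(a)] is used inside a
    tensor of length three; [contractl] and [contractr] multiply together the
    first, resp. the last, two factors of such a tensor by [F]. Applied to the
    two sides of coassociativity, they replace nested Sweedler sums. *)
Definition contractl (F : H -> H -> H) w : H2 := \sw_(s, c <- w) (sweedler F s \ox c).
Definition contractr (F : H -> H -> H) w : H2 :=
  \sw_(s, c <- w) \sw_(a, b <- s) (a \ox F b c).
Definition mulS a b := a * S b.
Definition Smul a b := S a * b.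
Definition counit_l t : H := \sw_(a, b <- t) ((counit a : k) *: b).
Definition counit_r t : H := \sw_(a, b <- t) ((counit b : k) *: a).

Lemma mulS_bilin : bilin mulS. Proof. by rewrite /mulS; lin. Qed.
Lemma Smul_bilin : bilin Smul. Proof. by rewrite /Smul; lin. Qed.

Lemma contractl_linear F : linear (contractl F).
Proof. by rewrite /contractl; lin. Qed.
Lemma contractr_linear F : linear (contractr F).
Proof. by rewrite /contractr; lin. Qed.
Lemma counit_l_linear : linear counit_l. Proof. by rewrite /counit_l; lin. Qed.
Lemma counit_r_linear : linear counit_r. Proof. by rewrite /counit_r; lin. Qed.

Lemma contractlE F s c : contractl F (s \ox c) = sweedler F s \ox c.
Proof. by rewrite /contractl sweedlerE //; lin. Qed.
Lemma contractlE3 F a b c : bilin F -> contractl F (a \ox b \ox c) = F a b \ox c.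
Proof. by move=> bF; rewrite contractlE sweedlerE. Qed.
Lemma contractrE F a b c : bilin F -> contractr F (a \ox b \ox c) = a \ox F b c.
Proof.
move=> [lFr lFl]; rewrite /contractr sweedlerE; last first.
  split=> u; first by apply: lin_in_sw => *; apply: lin_purer; apply: lFr.
  by lin.
by rewrite sweedlerE //; split=> u; [apply: lin_purer | lin].
Qed.
Lemma counit_lE a b : counit_l (a \ox b) = (counit a : k) *: b.
Proof. by rewrite /counit_l sweedlerE //; lin. Qed.
Lemma counit_rE a b : counit_r (a \ox b) = (counit b : k) *: a.
Proof. by rewrite /counit_r sweedlerE //; lin. Qed.

Lemma contractr_pure3 F a s : bilin F -> contractr F (pure3 a s) = a \ox sweedler F s.
Proof.
move=> bF; move: s; apply: tens_ext => [||b c].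
- by apply: lin_comp; [apply: contractr_linear | apply: pure3_linear].
- by lin.
by rewrite pure3E contractrE // sweedlerE.
Qed.

Lemma counitl_coprod x : counit_l (coprod x) = x. Proof. exact: counitl. Qed.
Lemma counitr_coprod x : counit_r (coprod x) = x. Proof. exact: counitr. Qed.
Lemma mulS_coprod x : sweedler mulS (coprod x) = (counit x : k)%:A.
Proof. exact: antipoder. Qed.
Lemma Smul_coprod x : sweedler Smul (coprod x) = (counit x : k)%:A.
Proof. exact: antipodel. Qed.

Lemma Smul_mulr s y : sweedler Smul (s * (1 \ox y)) = sweedler Smul s * y.
Proof.
move: s; apply: tens_ext => [||a b]; [lin|lin|].
by rewrite pureM mulr1 !sweedlerE /Smul ?mulrA //; lin.
Qed.

(** [galois] is the canonical map of H as a Galois extension of k: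
    [x (x) y |-> Delta(x)(1 (x) y)]. *)
Definition galois s : H2 := \sw_(x, y <- s) (coprod x * (1 \ox y)).
Definition idS s : H2 := \sw_(a, b <- s) (a \ox S b).

Lemma galoisE x y : galois (x \ox y) = coprod x * (1 \ox y).
Proof. by rewrite /galois sweedlerE //; lin. Qed.
Lemma idSE a b : idS (a \ox b) = a \ox S b.
Proof. by rewrite /idS sweedlerE //; lin. Qed.

Lemma contractr_Smul t y :
  contractr Smul (id_coprod t * (1 \ox 1 \ox y)) = counit_r t \ox y.
Proof.
move: t; apply: tens_ext => [||p q].
- apply: lin_comp; first exact: contractr_linear.
  by apply: lin_mulr; apply: id_coprod_linear.
- by apply: lin_purel; apply: counit_r_linear.
rewrite id_coprodE -pure3E -pure3M mulr1 contractr_pure3; last exact: Smul_bilin.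
rewrite Smul_mulr Smul_coprod counit_rE mulr_algl.
by rewrite pure_scale pure_scaler.
Qed.

Lemma contractr_mulS t : contractr mulS (id_coprod t) = counit_r t \ox 1.
Proof.
move: t; apply: tens_ext => [||p q].
- by apply: lin_comp; [apply: contractr_linear | apply: id_coprod_linear].
- by apply: lin_purel; apply: counit_r_linear.
rewrite id_coprodE contractr_pure3; last exact: mulS_bilin.
by rewrite mulS_coprod counit_rE pure_scale pure_scaler.
Qed.

(** The left inverse is [x (x) y |-> sum x1 (x) S(x2) y]. *)
Lemma galois_inj : injective galois.
Proof.
suff gK : cancel galois (fun s => contractr Smul (coprod_id s)) by apply: can_inj gK.
move=> s; move: s; apply: tens_ext => [||x y].
- apply: lin_comp; first exact: contractr_linear.
  by apply: lin_comp; [apply: coprod_id_linear | rewrite /galois; lin].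
- by lin.
rewrite galoisE coprod_idM coprod_idE coprod_id_coprod rmorph1.
by rewrite contractr_Smul counitr_coprod.
Qed.

Lemma galois_idS s : galois (idS s) = contractr mulS (coprod_id s).
Proof.
move: s; apply: tens_ext => [||p q].
- by rewrite /galois /idS; lin.
- by apply: lin_comp; [apply: contractr_linear | apply: coprod_id_linear].
rewrite idSE galoisE coprod_idE; move: (coprod p); apply: tens_ext => [||a b].
- by lin.
- by apply: lin_comp; [apply: contractr_linear | lin].
by rewrite pureM mulr1 contractrE //; apply: mulS_bilin.
Qed.

Lemma galois_antipode x : galois (idS (coprod x)) = x \ox 1.
Proof. by rewrite galois_idS coprod_id_coprod contractr_mulS counitr_coprod. Qed.

Lemma counit_l_idS s : counit_l (idS s) = S (counit_l s).
Proof.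
move: s; apply: tens_ext => [||p q].
- by rewrite /counit_l /idS; lin.
- by apply: lin_map; apply: counit_l_linear.
by rewrite idSE !counit_lE linearZ.
Qed.

(** Both [sum a1 b1 (x) S(b2) S(a2)] and [sum (ab)1 (x) S((ab)2)] are sent to
    [ab (x) 1] by the injective map [galois]; applying the counit to the first
    factor gives the claim. *)
Lemma antipodeM a b : S (a * b) = S b * S a.
Proof.
pose W s t := \sw_(p, q <- s) \sw_(r, u <- t) ((p * r) \ox (S u * S q)).
have Wl t : linear (W^~ t) by rewrite /W; lin.
have Wr s : linear (W s) by rewrite /W; lin.
have WE p q r u : W (p \ox q) (r \ox u) = (p * r) \ox (S u * S q).
  by rewrite /W sweedlerE; [rewrite sweedlerE //|]; lin.
have lg : linear galois by rewrite /galois; lin.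
have lidS : linear idS by rewrite /idS; lin.
have gW s : galois (W s (coprod b)) = galois (idS s) * (b \ox 1).
  move: s; apply: tens_ext => [||p q].
  - by apply: lin_comp.
  - by apply: lin_mulr; apply: lin_comp.
  rewrite idSE galoisE -mulrA pureM mulr1 mul1r.
  rewrite -[b \ox S q](_ : (b \ox 1) * (1 \ox S q) = _); last first.
    by rewrite pureM mulr1 mul1r.
  rewrite -galois_antipode !mulrA; move: (coprod b); apply: tens_ext => [||r u].
  - by apply: lin_comp.
  - by apply: lin_mulr; apply: lin_mull; apply: lin_comp.
  by rewrite WE idSE !galoisE rmorphM -!mulrA pureM mulr1.
have cW s t : counit_l (W s t) = S (counit_l t) * S (counit_l s).
  move: s; apply: tens_ext => [||p q].
  - by apply: lin_comp; [apply: counit_l_linear | ].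
  - by apply: lin_mull; apply: lin_map; apply: counit_l_linear.
  move: t; apply: tens_ext => [||r u].
  - by apply: lin_comp; [apply: counit_l_linear | ].
  - by apply: lin_mulr; apply: lin_map; apply: counit_l_linear.
  by rewrite WE !counit_lE rmorphM !linearZ /= -scalerAl -scalerAr scalerA mulrC.
have e : W (coprod a) (coprod b) = idS (coprod (a * b)).
  apply: galois_inj; rewrite gW !galois_antipode.
  by rewrite pureM mulr1.
by rewrite -{1}[a * b]counitl_coprod -counit_l_idS -e cW !counitl_coprod.
Qed.

Lemma antipode1 : S 1 = 1.
Proof.
have := Smul_coprod 1; rewrite !rmorph1 scale1r.
by rewrite -[X in sweedler _ X]/(1 \ox 1) sweedlerE /Smul ?mulr1 //; lin.
Qed.

End Antipode.

Arguments mulS {k H} a b.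
Arguments Smul {k H} a b.

(** * Twists and their Galois maps *)

Section Twist.
Variables (k : fieldType) (H : hopfAlgType k).
Notation H2 := (tens H H).
Notation H3 := (tens (tens H H) H).
Notation S := (@antipode k H).
Implicit Types (a b c x y u v : H) (s t : H2) (w : H3).

Lemma coprod_id1 : coprod_id (1 : H2) = 1.
Proof. by rewrite -[1 in LHS]/(1 \ox 1) coprod_idE rmorph1. Qed.
Lemma pure3_1 : pure3 1 (1 : H2) = 1 :> H3.
Proof. by rewrite -[X in pure3 _ X]/(1 \ox 1) pure3E. Qed.

Lemma counit_lM s t : counit_l (s * t) = counit_l s * counit_l t.
Proof.
have l : linear (@counit_l k H) by apply: counit_l_linear.
move: s; apply: tens_ext => [||a b]; [by apply: lin_comp; [|lin]|by apply: lin_mulr|].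
move: t; apply: tens_ext => [||c d]; [by apply: lin_comp; [|lin]|by apply: lin_mull|].
by rewrite pureM !counit_lE rmorphM /= -scalerAl -scalerAr scalerA.
Qed.
Lemma counit_l1 : counit_l (1 : H2) = 1.
Proof. by rewrite -[X in counit_l X]/(1 \ox 1) counit_lE rmorph1 scale1r. Qed.
Lemma counit_r1 : counit_r (1 : H2) = 1.
Proof. by rewrite -[X in counit_r X]/(1 \ox 1) counit_rE rmorph1 scale1r. Qed.

Lemma mulS_mid a b s : sweedler mulS ((a \ox b) * s) = a * sweedler mulS s * S b.
Proof.
move: s; apply: tens_ext => [||c d]; [lin|lin|].
by rewrite pureM !sweedlerE ?/mulS ?antipodeM ?mulrA; [|lin|lin].
Qed.

(** On the left two factors, [a p1 S(b p2) = eps(p) a S(b)]: right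
    multiplication by a coproduct is absorbed, because [S] reverses products. *)
Lemma contractl_mulSM w t :
  contractl mulS (w * coprod_id t) = contractl mulS w * (1 \ox counit_l t).
Proof.
have l : linear (contractl (@mulS k H)) by apply: contractl_linear.
have l1 : linear (@coprod_id k H) by apply: coprod_id_linear.
have l2 : linear (@counit_l k H) by apply: counit_l_linear.
move: t; apply: tens_ext => [||p q].
- by apply: lin_comp => //; lin.
- by apply: lin_mull; lin.
rewrite coprod_idE counit_lE.
move: w; apply: tens_ext => [||s c]; [by apply: lin_comp => //; lin|lin|].
rewrite pureM !contractlE.
move: s; apply: tens_ext => [||a b]; [lin|lin|].
rewrite mulS_mid mulS_coprod sweedlerE; last exact: mulS_bilin.
by rewrite mulr_algr -scalerAl pureM mulr1 -scalerAr pure_scale pure_scaler.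
Qed.

Lemma contractl_mulSl a w :
  contractl mulS ((a \ox 1 \ox 1) * w) = (a \ox 1) * contractl mulS w.
Proof.
have l : linear (contractl (@mulS k H)) by apply: contractl_linear.
move: w; apply: tens_ext => [||s c]; [by apply: lin_comp => //; lin|by apply: lin_mull|].
rewrite pureM !contractlE mul1r.
by rewrite mulS_mid antipode1 mulr1 pureM mul1r.
Qed.

Lemma mul_contractl_mulS t :
  \sw_(a, b <- contractl mulS (id_coprod t)) (a * b) = counit_r t.
Proof.
have l : linear (contractl (@mulS k H)) by apply: contractl_linear.
move: t; apply: tens_ext => [||p q].
- by apply: lin_sw; apply: lin_comp => //; apply: id_coprod_linear.
- exact: counit_r_linear.
rewrite id_coprodE counit_rE -mulr_algr -Smul_coprod.
move: (coprod q); apply: tens_ext => [||a b].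
- by apply: lin_sw; apply: lin_comp => //; apply: pure3_linear.
- lin.
rewrite pure3E contractlE3; last exact: mulS_bilin.
by rewrite !sweedlerE /Smul ?mulrA //; lin.
Qed.

Lemma contractr_mulSM w t :
  contractr mulS (w * id_coprod t) = contractr mulS w * (counit_r t \ox 1).
Proof.
have l : linear (contractr (@mulS k H)) by apply: contractr_linear.
have l1 : linear (@id_coprod k H) by apply: id_coprod_linear.
have l2 : linear (@counit_r k H) by apply: counit_r_linear.
move: t; apply: tens_ext => [||p q].
- by apply: lin_comp => //; lin.
- by apply: lin_mull; lin.
rewrite id_coprodE counit_rE.
move: w; apply: tens_ext => [||s c]; [by apply: lin_comp => //; lin|lin|].
move: s; apply: tens_ext => [||a b]; [by apply: lin_comp => //; lin| |].
  by apply: lin_mulr; apply: lin_comp => //; lin.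
rewrite -pure3E -pure3M !contractr_pure3; try exact: mulS_bilin.
rewrite mulS_mid mulS_coprod sweedlerE; last exact: mulS_bilin.
by rewrite mulr_algr -scalerAl pureM mulr1 -scalerAr pure_scale pure_scaler.
Qed.

Lemma contractr_mulSl s w :
  contractr mulS ((s \ox 1) * w) = s * contractr mulS w.
Proof.
have l : linear (contractr (@mulS k H)) by apply: contractr_linear.
move: w; apply: tens_ext => [||t c]; [by apply: lin_comp => //; lin|by apply: lin_mull|].
rewrite pureM mul1r.
move: s; apply: tens_ext => [||a b]; [by apply: lin_comp => //; lin|lin|].
move: t; apply: tens_ext => [||a' b']; [by apply: lin_comp => //; lin| |].
  by apply: lin_mull; apply: lin_comp => //; lin.
by rewrite !pureM !contractrE ?pureM /mulS ?mulrA //; exact: mulS_bilin.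
Qed.

Lemma contractr_mulSr h w :
  contractr mulS ((1 \ox h) * w) = contractr mulS w * (1 \ox S h).
Proof.
have l : linear (contractr (@mulS k H)) by apply: contractr_linear.
move: w; apply: tens_ext => [||t c]; [by apply: lin_comp => //; lin|by apply: lin_mulr|].
rewrite pureM mul1r.
move: t; apply: tens_ext => [||a' b']; [by apply: lin_comp => //; lin| |].
  by apply: lin_mulr; apply: lin_comp => //; lin.
by rewrite !contractrE ?pureM /mulS ?antipodeM ?mulrA ?mulr1 //; exact: mulS_bilin.
Qed.

Lemma contractl_Smul t y :
  contractl Smul (coprod_id t * (y \ox 1 \ox 1)) = S y \ox counit_l t.
Proof.
have l : linear (contractl (@Smul k H)) by apply: contractl_linear.
have l1 : linear (@coprod_id k H) by apply: coprod_id_linear.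
have l2 : linear (@counit_l k H) by apply: counit_l_linear.
move: t; apply: tens_ext => [||p q]; [by apply: lin_comp => //; lin|lin|].
rewrite coprod_idE pureM mulr1 contractlE counit_lE pure_scaler -pure_scale.
congr (_ \ox _); rewrite -mulr_algr -Smul_coprod; move: (coprod p).
apply: tens_ext => [||a b]; [lin|lin|].
by rewrite pureM mulr1 !sweedlerE /Smul ?antipodeM ?mulrA //; lin.
Qed.

(** The 2-cocycles for H^*, described by identities in tensor powers of H; the
    inverse D is part of the data because it enters all the formulas. *)
Record twist (C D : H2) : Prop := {
  twistK : C * D = 1;
  twistVK : D * C = 1;
  twist_cocycle : (C \ox 1) * coprod_id C = pure3 1 C * id_coprod C;
  twist_counitl : counit_l C = 1;
  twist_counitr : counit_r C = 1
}.

(** Left multiplication by [y] is injective, hence surjective by finite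
    dimension, and a right inverse of [y] is then [x]. *)
Lemma right_inverse_sym x y : x * y = 1 -> y * x = 1.
Proof.
move=> xy; have bij : bijective (fun z => y * z).
  apply: inj_linear_bij => //; first by lin.
  by apply: (can_inj (g := fun z => x * z)) => z; rewrite mulrA xy mul1r.
have [g _ gK] := bij; have := gK 1; set z := g 1 => yz.
by rewrite -[x in LHS]mulr1 -yz [x * _]mulrA xy mul1r.
Qed.

Definition galois_l t : H2 := \sw_(x, y <- t) (coprod x * (y \ox 1)).

Section TwistTheory.
Variables (C D : H2) (hC : twist C D).
(* The antipode for the coproduct [C Delta(-) D] is [Q S(-) Q'], with Q and Q'
   inverse to each other. *)
Let Q := sweedler mulS C.
Let Q' := sweedler Smul D.

Let CD : C * D = 1 := twistK hC.
Let DC : D * C = 1 := twistVK hC.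
Let lcl : linear (@counit_l k H) := @counit_l_linear k H.

Lemma twist_counitlV : counit_l D = 1.
Proof. by have := counit_lM C D; rewrite CD counit_l1 (twist_counitl hC) mul1r. Qed.

Lemma coprod_idCD : coprod_id C * coprod_id D = 1.
Proof. by rewrite -coprod_idM CD coprod_id1. Qed.

(** The cocycle identity reads [(id (x) Delta)(C) (Delta (x) id)(D) = D23 C12];
    the contraction absorbs the second factor on the left-hand side and turns
    the right-hand side into [sum C1 S(C2) S(D1) (x) D2]. *)
Lemma contractl_twist :
  contractl mulS (id_coprod C) = \sw_(r, s <- D) ((Q * S r) \ox s).
Proof.
have l : linear (contractl (@mulS k H)) by apply: contractl_linear.
have -> : contractl mulS (id_coprod C)
        = contractl mulS (pure3 1 D * (C \ox 1)).
  have -> : pure3 1 D * (C \ox 1) = id_coprod C * coprod_id D.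
    have DC3 : pure3 1 D * pure3 1 C = 1 by rewrite -pure3M DC mulr1 pure3_1.
    rewrite -[id_coprod C]mul1r -DC3 -[_ * _ * id_coprod C]mulrA -(twist_cocycle hC).
    by rewrite -!mulrA coprod_idCD mulr1.
  by rewrite contractl_mulSM twist_counitlV mulr1.
rewrite /Q; move: (D); apply: tens_ext => [||r s].
- by apply: lin_comp => //; apply: lin_mulr; apply: pure3_linear.
- lin.
rewrite pure3E sweedlerE; last lin.
move: (C); apply: tens_ext => [||p q]; [by apply: lin_comp => //; lin|lin|].
rewrite !pureM !mul1r mulr1 contractlE3; last exact: mulS_bilin.
by rewrite sweedlerE /mulS ?antipodeM ?mulrA //; lin.
Qed.

(** Multiplying together the two factors of [contractl_twist] gives
    [sum C1 S(C2_1) C2_2 = 1] on the left and [Q Q'] on the right. *)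
Lemma twist_QK : Q * Q' = 1.
Proof.
rewrite -(twist_counitr hC) -mul_contractl_mulS contractl_twist /Q'.
move: (D); apply: tens_ext => [||r s]; [lin|lin|].
by rewrite !sweedlerE /Smul ?mulrA //; lin.
Qed.

Lemma twist_QVK : Q' * Q = 1.
Proof. exact/right_inverse_sym/twist_QK. Qed.

(** The same argument, with [(Delta (x) id)(C) = D12 C23 (id (x) Delta)(C)]. *)
Lemma contractr_twist :
  contractr mulS (coprod_id C) = D * (1 \ox Q).
Proof.
have -> : coprod_id C = ((D \ox 1) * pure3 1 C) * id_coprod C.
  by rewrite -mulrA -(twist_cocycle hC) mulrA pureM DC mulr1 mul1r.
rewrite contractr_mulSM (twist_counitr hC) mulr1 contractr_mulSl.
by rewrite contractr_pure3 //; apply: mulS_bilin.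
Qed.

Definition twisted_galois_l t : H2 := \sw_(h, u <- t) ((h \ox 1) * (C * coprod u)).

Lemma twisted_galois_l_linear : linear twisted_galois_l.
Proof. by rewrite /twisted_galois_l; lin. Qed.

(** The map [a (x) b |-> sum a S(b1) (x) b2] sends [(h (x) 1) C Delta(u)] to
    [sum h Q S(D1) (x) D2 u], by [contractl_twist]. Here D is cancelled by
    [S(C1)] on the right of the first factor and [C2] on the left of the second,
    because S reverses products; then [Q'] cancels [Q]. *)
Lemma twisted_galois_l_inj : injective twisted_galois_l.
Proof.
pose P s : H2 := \sw_(a, b <- s) \sw_(p, q <- C) ((a * S p * Q') \ox (q * b)).
suff gK : cancel twisted_galois_l (fun s => P (contractl mulS (id_coprod s))).
  exact: can_inj gK.
have lN : linear (fun s => contractl mulS (id_coprod s)).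
  by apply: lin_comp; [apply: contractl_linear | apply: id_coprod_linear].
have lP : linear P by rewrite /P; lin.
move=> t; move: t; apply: tens_ext => [||h u].
- exact: (lin_comp lP (lin_comp lN twisted_galois_l_linear)).
- by lin.
have -> : twisted_galois_l (h \ox u) = (h \ox 1) * (C * coprod u).
  by rewrite /twisted_galois_l sweedlerE //; lin.
rewrite !id_coprodM id_coprodE rmorph1 -[X in pure3 h X]/(1 \ox 1) pure3E.
rewrite contractl_mulSl -coprod_id_coprod contractl_mulSM counitl_coprod.
rewrite contractl_twist.
transitivity ((h * Q \ox 1) * (\sw_(a, b <- C * D) (S a \ox b)) * (Q' \ox u)).
  rewrite {1}/P; move: (D); apply: tens_ext => [||r s]; [lin|lin|].
  rewrite sweedlerE; last lin.
  rewrite !pureM mul1r sweedlerE; last lin.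
  move: (C); apply: tens_ext => [||p q]; [lin|lin|].
  rewrite pureM !sweedlerE; try by lin.
  by rewrite !pureM antipodeM mulr1 mul1r !mulrA.
rewrite CD -[X in sweedler _ X]/(1 \ox 1) sweedlerE; last lin.
by rewrite antipode1 !pureM !mulr1 mul1r -mulrA twist_QK mulr1.
Qed.

Definition twisted_galois_r t : H2 := \sw_(u, h <- t) ((1 \ox h) * (C * coprod u)).

Lemma twisted_galois_r_linear : linear twisted_galois_r.
Proof. by rewrite /twisted_galois_r; lin. Qed.

Lemma contractr_twisted_galois_r u h :
  contractr mulS (coprod_id ((1 \ox h) * (C * coprod u)))
  = D * (u \ox (Q * S h)).
Proof.
rewrite !coprod_idM coprod_idE rmorph1 contractr_mulSr coprod_id_coprod.
rewrite contractr_mulSM counitr_coprod contractr_twist -!mulrA !pureM.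
by rewrite mulr1 !mul1r.
Qed.

(** By [contractr_twist], the map [a (x) b |-> sum a1 (x) a2 S(b)] sends
    [(1 (x) h) C Delta(u)] to [D (u (x) Q S(h))]. *)
Lemma twisted_galois_r_inj : injective S -> injective twisted_galois_r.
Proof.
move=> Si; apply: inj_linear; first exact: twisted_galois_r_linear.
move=> t t0.
have e : forall t, C * contractr mulS (coprod_id (twisted_galois_r t))
                 = \sw_(u, h <- t) (u \ox (Q * S h)).
  apply: tens_ext => [||u h].
  - apply: lin_mull; apply: lin_comp; first exact: contractr_linear.
    by apply: lin_comp; [exact: coprod_id_linear | exact: twisted_galois_r_linear].
  - by lin.
  rewrite /twisted_galois_r !sweedlerE; try by lin.
  by rewrite contractr_twisted_galois_r mulrA CD mul1r.
have [g gK] := inj_linear_retract (linearP antipode) Si.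
have -> : t = \sw_(a, b <- \sw_(u, h <- t) (u \ox (Q * S h)))
                (a \ox g (Q' * b)).
  clear t0; move: t; apply: tens_ext => [||u h]; [lin|lin|].
  rewrite !sweedlerE; try by lin.
  by rewrite mulrA twist_QVK mul1r gK.
rewrite -e t0 (linear0_ (@coprod_id_linear k H)).
by rewrite (linear0_ (@contractr_linear k H _)) mulr0 linear0.
Qed.

End TwistTheory.

(** Up to exchanging the factors, [a (x) b |-> sum S(a) b1 (x) b2] sends
    [Delta(x)(y (x) 1)] to [S(y) (x) x]. *)
Lemma galois_l_inj : injective S -> injective galois_l.
Proof.
move=> Si; have [g gK] := inj_linear_retract (linearP antipode) Si.
suff galK : cancel galois_l (fun s =>
    \sw_(a, b <- contractl Smul (id_coprod s)) (b \ox g a)).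
  by apply: can_inj galK.
move=> t; move: t; apply: tens_ext => [||x y].
- apply: lin_sw; apply: lin_comp; first exact: contractl_linear.
  by apply: lin_comp; [exact: id_coprod_linear | rewrite /galois_l; lin].
- by lin.
rewrite /galois_l sweedlerE; last lin.
rewrite id_coprodM -coprod_id_coprod id_coprodE rmorph1 -[X in pure3 y X]/(1 \ox 1) pure3E.
rewrite contractl_Smul counitl_coprod sweedlerE; last lin.
by rewrite gK.
Qed.

End Twist.

(** * The R-matrix is a twist, and the antipode is bijective *)

Section Rmatrix.
Variables (k : fieldType) (H : hopfAlgType k).
Notation H2 := (tens H H).
Notation H3 := (tens (tens H H) H).
Notation S := (@antipode k H).
Implicit Types (a b c x y u v : H) (s t : H2) (w : H3).

Lemma flip_linear : linear (@flip k H H). Proof. by rewrite /flip; lin. Qed.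
Lemma flipE a b : flip (a \ox b) = b \ox a.
Proof. by rewrite /flip sweedlerE //; lin. Qed.
Lemma flipK : involutive (@flip k H H).
Proof.
have l := flip_linear; move=> t; move: t; apply: tens_ext => [||a b]; [lin|lin|].
by rewrite !flipE.
Qed.
Lemma flipM s t : flip (s * t) = flip s * flip t.
Proof.
have l := flip_linear.
move: s; apply: tens_ext => [||a b]; [by apply: lin_comp => //; lin|by apply: lin_mulr|].
move: t; apply: tens_ext => [||c d]; [by apply: lin_comp => //; lin|by apply: lin_mull|].
by rewrite pureM !flipE pureM.
Qed.

Definition flip12 w : H3 := \sw_(s, c <- w) (flip s \ox c).
Lemma flip12_linear : linear flip12. Proof. by rewrite /flip12; lin. Qed.
Lemma flip12E s c : flip12 (s \ox c) = flip s \ox c.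
Proof. by have l := flip_linear; rewrite /flip12 sweedlerE //; lin. Qed.
Lemma flip12M w w' : flip12 (w * w') = flip12 w * flip12 w'.
Proof.
have l := flip12_linear.
move: w; apply: tens_ext => [||a b]; [by apply: lin_comp => //; lin|by apply: lin_mulr|].
move: w'; apply: tens_ext => [||c d]; [by apply: lin_comp => //; lin|by apply: lin_mull|].
by rewrite pureM !flip12E pureM flipM.
Qed.

Lemma leg12E t : leg12 t = t \ox 1.
Proof.
by move: t; apply: tens_ext => [||a b]; rewrite /leg12; [lin|lin|rewrite sweedlerE //; lin].
Qed.
Lemma leg23E t : leg23 t = pure3 1 t. Proof. by []. Qed.
Lemma leg13E a b : leg13 (a \ox b) = a \ox 1 \ox b.
Proof. by rewrite /leg13 sweedlerE //; lin. Qed.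
Lemma flip12_leg13 t : flip12 (leg13 t) = leg23 t.
Proof.
have l := flip12_linear; move: t; apply: tens_ext => [||a b].
- by apply: lin_comp => //; rewrite /leg13; lin.
- by rewrite /leg23; lin.
by rewrite leg13E flip12E flipE leg23E pure3E.
Qed.
Lemma flip12_leg23 t : flip12 (leg23 t) = leg13 t.
Proof.
have l := flip12_linear; move: t; apply: tens_ext => [||a b].
- by apply: lin_comp => //; rewrite /leg23; lin.
- by rewrite /leg13; lin.
by rewrite leg13E leg23E pure3E flip12E flipE.
Qed.

Variables (R : H2) (hR : is_Rmatrix R).

(** Since [R Delta = Delta^op R], the left-hand side is
    [(Delta^op (x) id)(R) R12 = R23 R13 R12]. *)
Lemma Rmatrix_yang_baxter : (R \ox 1) * coprod_id R = pure3 1 R * id_coprod R.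
Proof.
have e t : (R \ox 1) * coprod_id t = flip12 (coprod_id t) * (R \ox 1).
  move: t; apply: tens_ext => [||p q].
  - by apply: lin_mull; apply: coprod_id_linear.
  - by apply: lin_mulr; apply: lin_comp; [exact: flip12_linear | exact: coprod_id_linear].
  by rewrite coprod_idE flip12E !pureM (Rmatrix_intertwines hR) mulr1 mul1r.
rewrite e (Rmatrix_coprodl hR) (Rmatrix_coprodr hR) flip12M flip12_leg13 flip12_leg23.
by rewrite leg12E leg23E mulrA.
Qed.

Let lcl : linear (@counit_l k H) := @counit_l_linear k H.

(** Applying the counit to the first factor of [(Delta (x) id)R = R13 R23] gives
    [R = (1 (x) e) R], with [e] the element to be computed and [R] invertible. *)
Lemma Rmatrix_counitl : counit_l R = 1.
Proof.
pose E w : H2 := \sw_(s, c <- w) (counit_l s \ox c).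
have lE : linear E by rewrite /E; lin.
have EE s c : E (s \ox c) = counit_l s \ox c by rewrite /E sweedlerE //; lin.
have EM w w' : E (w * w') = E w * E w'.
  move: w; apply: tens_ext => [||s c]; [by apply: lin_comp => //; lin|by apply: lin_mulr|].
  move: w'; apply: tens_ext => [||s' c']; [by apply: lin_comp => //; lin|by apply: lin_mull|].
  by rewrite pureM !EE counit_lM pureM.
have E13 t : E (leg13 t) = 1 \ox counit_l t.
  move: t; apply: tens_ext => [||a b].
  - by apply: lin_comp => //; rewrite /leg13; lin.
  - lin.
  by rewrite leg13E EE !counit_lE pure_scale pure_scaler.
have E23 t : E (leg23 t) = t.
  move: t; apply: tens_ext => [||a b].
  - by apply: lin_comp => //; rewrite /leg23; lin.
  - lin.
  by rewrite leg23E pure3E EE counit_lE rmorph1 scale1r.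
have Ec t : E (coprod_id t) = t.
  move: t; apply: tens_ext => [||a b].
  - by apply: lin_comp => //; exact: coprod_id_linear.
  - lin.
  by rewrite coprod_idE EE counitl_coprod.
have e : (1 \ox counit_l R) * R = 1 * R.
  by rewrite mul1r -[RHS]Ec (Rmatrix_coprodl hR) EM E13 E23.
have /(congr1 (@counit_l k H)) := mulIr (Rmatrix_unit hR) e.
by rewrite counit_lE rmorph1 scale1r counit_l1.
Qed.

Lemma Rmatrix_counitr : counit_r R = 1.
Proof.
pose E w : H2 := \sw_(s, c <- w) ((counit c : k) *: s).
have lE : linear E by rewrite /E; lin.
have EE s c : E (s \ox c) = (counit c : k) *: s by rewrite /E sweedlerE //; lin.
have EM w w' : E (w * w') = E w * E w'.
  move: w; apply: tens_ext => [||s c]; [by apply: lin_comp => //; lin|by apply: lin_mulr|].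
  move: w'; apply: tens_ext => [||s' c']; [by apply: lin_comp => //; lin|by apply: lin_mull|].
  by rewrite pureM !EE rmorphM /= -scalerAl -scalerAr scalerA.
have E13 t : E (leg13 t) = counit_r t \ox 1.
  move: t; apply: tens_ext => [||a b].
  - by apply: lin_comp => //; rewrite /leg13; lin.
  - lin.
  by rewrite leg13E EE counit_rE pure_scale.
have Ec t : E (id_coprod t) = t.
  move: t; apply: tens_ext => [||a b].
  - by apply: lin_comp => //; exact: id_coprod_linear.
  - lin.
  rewrite id_coprodE -{2}[b]counitr_coprod; move: (coprod b).
  apply: tens_ext => [||p q].
  - by apply: lin_comp => //; exact: pure3_linear.
  - lin.
  by rewrite pure3E EE counit_rE pure_scaler.
have e : (counit_r R \ox 1) * R = 1 * R.
  by rewrite mul1r -[RHS]Ec (Rmatrix_coprodr hR) EM E13 leg12E EE rmorph1 scale1r.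
have /(congr1 (@counit_r k H)) := mulIr (Rmatrix_unit hR) e.
by rewrite counit_rE rmorph1 scale1r counit_r1.
Qed.

Lemma Rmatrix_twist : twist R R^-1.
Proof.
have uR := Rmatrix_unit hR; split; [exact: mulrV|exact: mulVr| | |].
- exact: Rmatrix_yang_baxter.
- exact: Rmatrix_counitl.
- exact: Rmatrix_counitr.
Qed.

(** As R is a twist, [twisted_galois_l R] is bijective, so that
    [(1 (x) x) R] has the form
    [sum (h (x) 1) R Delta(u) = sum (h (x) 1) Delta^op(u) R]. Cancelling R and
    exchanging the factors, [x (x) 1 = sum (1 (x) h) Delta(u)]; the map
    [a (x) b |-> sum a1 (x) a2 S(b)] turns this into
    [Delta(x) = sum u (x) S(h)], and hence [x = S(sum eps(u) h)]. *)
Lemma antipode_inj : injective S.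
Proof.
have lS : linear S by apply: linearP.
have [g _ gK] : bijective (twisted_galois_l R).
  apply: inj_linear_bij => //; first exact: twisted_galois_l_linear.
  exact: (twisted_galois_l_inj Rmatrix_twist).
suff Ssurj x : exists y, S y = x by apply: (surj_linear_inj lS).
have := gK ((1 \ox x) * R); set t := g _ => et.
exists (\sw_(h, u <- t) ((counit u : k) *: h)).
have e1 : \sw_(h, u <- t) ((1 \ox h) * coprod u) = x \ox 1.
  apply: (can_inj flipK); rewrite flipE; apply: (mulIr (Rmatrix_unit hR)).
  rewrite -et; move: (t); apply: tens_ext => [||h u].
  - apply: lin_mulr; apply: lin_comp; [exact: flip_linear | lin].
  - exact: twisted_galois_l_linear.
  rewrite /twisted_galois_l !sweedlerE; try by lin.
  by rewrite flipM flipE -mulrA (Rmatrix_intertwines hR).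
have e2 s : contractr mulS
    (coprod_id (\sw_(h, u <- s) ((1 \ox h) * coprod u)))
   = \sw_(h, u <- s) (u \ox S h).
  move: s; apply: tens_ext => [||h u].
  - apply: lin_comp; first exact: contractr_linear.
    by apply: lin_comp; [exact: coprod_id_linear | lin].
  - lin.
  rewrite !sweedlerE; try by lin.
  rewrite coprod_idM coprod_idE rmorph1 contractr_mulSr coprod_id_coprod.
  by rewrite contractr_mulS counitr_coprod pureM mulr1 mul1r.
have := e2 t; rewrite e1 coprod_idE.
rewrite -[coprod x \ox 1](mulr1 _) contractr_mulSl -[X in contractr _ X]/(1 \ox 1 \ox 1).
rewrite contractrE; last exact: mulS_bilin.
rewrite /mulS antipode1 !mulr1 => /(congr1 (@counit_l k H)).
rewrite counitl_coprod => ->; move: (t); apply: tens_ext => [||h u]; [lin|lin|].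
rewrite !sweedlerE; try by lin.
by rewrite counit_lE linearZ.
Qed.

End Rmatrix.

(** * Duality and 2-cocycles *)

Section Duality.
Variable k : fieldType.

Lemma coord_linear (U : vectType k) i : linear (coord (vbasis {:U}) i : U -> k^o).
Proof. by move=> c u v; rewrite linearP. Qed.

Lemma tens_sep (U V : vectType k) (t : tens U V) :
  (forall (f : dual U) (g : dual V), \sw_(a, b <- t) (ev f a * ev g b) = 0) -> t = 0.
Proof.
pose e (W : vectType k) i : dual W := linfun (coord (vbasis {:W}) i : W -> k^o).
have te s i j : \sw_(a, b <- s) (ev (e U i) a * ev (e V j) b) = s i j.
  move: s; apply: tens_ext => [||a b]; [exact: sweedler_linear|by move=> c u v; rewrite !mxE|].
  rewrite sweedlerE; last by apply: mul_bil; apply: linearP.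
  by rewrite /ev !linfun_linE ?mxE //; apply: coord_linear.
by move=> t0; apply/matrixP => i j; rewrite -te t0 mxE.
Qed.

Lemma ev_sep (U : vectType k) (x y : U) : (forall f : dual U, ev f x = ev f y) -> x = y.
Proof.
move=> e; rewrite (coord_vbasis (memvf x)) (coord_vbasis (memvf y)).
apply: eq_bigr => i _; congr (_ *: _).
have := e (linfun (coord (vbasis {:U}) i : U -> k^o)).
by rewrite /ev !linfun_linE //; apply: coord_linear.
Qed.

Lemma dual_reflexive (U : vectType k) (n : dual (dual U)) :
  exists u, forall f, ev n f = ev f u.
Proof.
pose e i : dual U := linfun (coord (vbasis {:U}) i : U -> k^o).
exists (\sum_(i < \dim {:U}) (ev n (e i) : k) *: (vbasis {:U})`_i) => f.
have {1}-> : f = \sum_(i < \dim {:U}) (ev f (vbasis {:U})`_i : k) *: e i.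
  apply/lfunP => x; rewrite sum_lfunE [in LHS](coord_vbasis (memvf x)) linear_sum.
  apply: eq_bigr => i _; rewrite lfunE /= [LHS]linearZ_LR /=.
  rewrite /e linfun_linE; last exact: coord_linear.
  by rewrite -[LHS]/(_ * _) -[RHS]/(_ * _) mulrC.
rewrite /ev !linear_sum; apply: eq_bigr => i _; rewrite [LHS]linearZ_LR [RHS]linearZ_LR /=.
by rewrite -[LHS]/(_ * _) -[RHS]/(_ * _) mulrC.
Qed.
End Duality.

Section Cocycle.
Variables (k : fieldType) (H : hopfAlgType k).
Notation H2 := (tens H H).
Notation H3 := (tens (tens H H) H).
Implicit Types (f g l c : dual H) (x y : H) (s t : H2).

Lemma tens_pair_sep (t : tens (dual H) (dual H)) :
  (forall p : H2, \sw_(f, g <- t) tpair p f g = 0) -> t = 0.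
Proof.
move=> t0; apply: tens_sep => m n.
have [u mu] := dual_reflexive m; have [v nv] := dual_reflexive n.
by rewrite -(t0 (u \ox v)); apply: eq_sweedler => f g; rewrite mu nv tpairE.
Qed.

Lemma ev3_sep (w w' : H3) : (forall f g l, ev3 f g l w = ev3 f g l w') -> w = w'.
Proof.
move=> e; apply/eqP; rewrite -subr_eq0; apply/eqP; apply: tens_sep => m l.
pose P (w : H3) : H2 := \sw_(s, c <- w) ((ev l c : k) *: s).
have lP : linear P by rewrite /P; lin.
have PE v : \sw_(s, c <- v) (ev m s * ev l c) = ev m (P v).
  rewrite /P (sweedler_comp (h := ev m)); last exact: linearP.
  by apply: eq_sweedler => s c; rewrite [RHS]linearZ_LR mulrC.
rewrite PE; suff -> : P (w - w') = 0 by apply: linear0_; apply: linearP.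
have eP v : forall f g, ev3 f g l v = tpair (P v) f g.
  move=> f g; rewrite /ev3 /P (sweedler_comp (h := fun s => tpair s f g));
    last exact: tpair_linear.
  apply: eq_sweedler => s c; rewrite mulrC -[ev l c *: s]addr0 tpair_linear.
  by rewrite (linear0_ (@tpair_linear _ _ f g)) addr0.
have -> : P (w - w') = P w - P w'.
  by rewrite addrC -scaleN1r lP scaleN1r addrC.
apply/eqP; rewrite subr_eq0; apply/eqP; apply: tpair_inj => f g.
by rewrite -!eP.
Qed.

Lemma tpair_1r t f : tpair t f 1 = ev f (counit_r t).
Proof.
move: t; apply: tens_ext => [||a b].
- exact: tpair_linear.
- apply: lin_comp; [exact: ev_linear | exact: counit_r_linear].
by rewrite tpairE counit_rE dual_oneE [RHS]linearZ_LR mulrC.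
Qed.
Lemma tpair_1l t f : tpair t 1 f = ev f (counit_l t).
Proof.
move: t; apply: tens_ext => [||a b].
- exact: tpair_linear.
- apply: lin_comp; [exact: ev_linear | exact: counit_l_linear].
by rewrite tpairE counit_lE dual_oneE [RHS]linearZ_LR.
Qed.

(** Each identity of a twist is the corresponding cocycle axiom with the
    functionals removed, as these separate tensors. *)
Lemma cocycle_twist (C : H2) : is_2cocycle C -> twist C C^-1.
Proof.
move=> hC; have uC := conv_invertible_unit (cocycle_inv hC).
split; [exact: mulrV | exact: mulVr | | | ].
- by apply: ev3_sep; apply: twdual_cocycle hC.
- by apply: ev_sep => f; rewrite -tpair_1l (cocycle_1l hC).
- by apply: ev_sep => f; rewrite -tpair_1r (cocycle_1r hC).
Qed.

Definition ltrans x f : dual H := linfun (fun y => ev f (x * y)).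
Lemma ltransE x f y : ev (ltrans x f) y = ev f (x * y).
Proof.
by rewrite {1}/ev linfun_linE // => c u v; rewrite mulrDr -scalerAr ev_linear.
Qed.

Lemma tpair_ltrans a b s f g :
  tpair ((a \ox b) * s) f g = tpair s (ltrans a f) (ltrans b g).
Proof.
move: s; apply: tens_ext => [c u v|c u v|a1 b1].
- by rewrite mulrDr -scalerAr tpair_linear.
- by rewrite tpair_linear.
by rewrite pureM !tpairE !ltransE.
Qed.

Lemma tpair_flip s f g : tpair (flip s) f g = tpair s g f.
Proof.
move: s; apply: tens_ext => [||a b].
- apply: (lin_comp (g := fun t => tpair t f g)); [exact: tpair_linear|exact: flip_linear].
- exact: tpair_linear.
by rewrite flipE !tpairE mulrC.
Qed.

Lemma ltrans_linear f : linear (fun x => ltrans x f).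
Proof.
move=> c x y; apply/lfunP => z; rewrite -[LHS]/(ev _ z) -[RHS]/(ev (_ *: _ + _) z).
by rewrite ev_linearl !ltransE mulrDl -scalerAl ev_linear.
Qed.
Lemma ltransZ (a : k) x f : ltrans (a *: x) f = a *: ltrans x f.
Proof.
by rewrite -[a *: x]addr0 ltrans_linear (linear0_ (ltrans_linear f)) addr0.
Qed.
Lemma ltrans1 f : ltrans 1 f = f.
Proof. by apply/lfunP => z; rewrite -[LHS]/(ev _ z) ltransE mul1r. Qed.
Lemma rtrans1 f : rtrans 1 f = f.
Proof. by apply/lfunP => z; rewrite -[LHS]/(ev _ z) rtransE mulr1. Qed.
Lemma rtransM x y f : rtrans (x * y) f = rtrans x (rtrans y f).
Proof. by apply/lfunP => z; rewrite -[LHS]/(ev _ z) -[RHS]/(ev _ z) !rtransE mulrA. Qed.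
Lemma rtrans_linear f : linear (fun x => rtrans x f).
Proof.
move=> c x y; apply/lfunP => z; rewrite -[LHS]/(ev _ z) -[RHS]/(ev (_ *: _ + _) z).
by rewrite ev_linearl !rtransE mulrDr -scalerAr ev_linear.
Qed.

End Cocycle.

(** * The Azumaya maps of the twisted dual *)

Section AzumayaTwisted.
Variables (k : fieldType) (H : hopfAlgType k).
Notation H2 := (tens H H).
Notation S := (@antipode k H).
Variables (R C : H2) (hR : is_Rmatrix R) (hC : is_2cocycle C).
Notation A := (twdual hC).
Notation T := (twistR C R).
Implicit Types (f g c : dual H) (x y : H) (s t X : H2).

Let hT := cocycle_twist hC.

Lemma twdual_evM (f g : A) x : ev (f * g : A) x = tpair (C * coprod x) f g.
Proof. exact: twdual_mulE. Qed.

Lemma twistRE : T * C = flip C * R.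
Proof. by rewrite /twistR -mulrA (twistVK hT) mulr1. Qed.

(** At [y], the left-hand side is [c (x) g] evaluated on
    [C Delta(y) R21 = C R21 Delta^op(y)], which is the flip of
    [(tau C) R Delta(y) = R_C C Delta(y)]. *)
Lemma twdual_braiding (g c : A) :
  \sw_(r1, r2 <- R) (hact r2 c * hact r1 g : A)
  = \sw_(s1, s2 <- T) ((ltrans s1 g : A) * (ltrans s2 c : A)) :> A.
Proof.
apply/lfunP => y; rewrite -[LHS]/(ev _ y) -[RHS]/(ev _ y).
rewrite (sweedler_comp (h := fun u : A => ev u y)); last exact: ev_linearl.
rewrite [RHS](sweedler_comp (h := fun u : A => ev u y)); last exact: ev_linearl.
transitivity (tpair (C * coprod y * flip R) c g).
  rewrite /flip (sweedler_comp (h := fun t => tpair (C * coprod y * t) c g)); last first.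
    apply: (lin_comp (g := fun t => tpair t c g)); [exact: tpair_linear | lin].
  apply: eq_sweedler => r1 r2.
  by rewrite twdual_evM !twdual_hactE !twdual_act_rtrans -tpair_rtrans.
have flipR : coprod y * flip R = flip R * flip (coprod y).
  by rewrite -[coprod y in LHS]flipK -!flipM (Rmatrix_intertwines hR).
rewrite -mulrA flipR mulrA -[tpair _ c g]tpair_flip !flipM !flipK -twistRE -mulrA.
rewrite [X in tpair (X * _)]tensE.
rewrite (sweedler_comp (h := fun t => tpair (t * (C * coprod y)) g c)); last first.
  apply: (lin_comp (g := fun t => tpair t g c)); [exact: tpair_linear | lin].
by apply: eq_sweedler => s1 s2; rewrite twdual_evM tpair_ltrans.
Qed.

Definition theta_tr (c : dual H) : H := \sw_(s1, s2 <- T) ((ev c s1 : k) *: s2).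

Lemma theta_linear : linear (@theta k H T : dual H -> H).
Proof.
move=> d u v; rewrite /theta -sweedlerD; apply: eq_sweedler => s1 s2.
by rewrite ev_linearl scalerDl -scalerA.
Qed.
Lemma theta_tr_linear : linear theta_tr.
Proof.
move=> d u v; rewrite /theta_tr -sweedlerD; apply: eq_sweedler => s1 s2.
by rewrite ev_linearl scalerDl -scalerA.
Qed.
Let lth := theta_linear.
Let lth' := theta_tr_linear.
Let lrt c : linear (fun v => rtrans v c) := rtrans_linear c.

(** For [X = C Delta(x)], the functionals [c |-> F'(f (x) g)(c)(x)] and
    [c |-> G'(f (x) g)(c)(x)] are pairings of [f (x) g] with [transF X c] and
    [transG X c]; a general [X] is allowed in order to absorb translations of
    [c], see [transF_shift] and [transG_shift]. *)
Definition transF X c : H2 :=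
  twisted_galois_r C (\sw_(u, v <- X) (u \ox theta T (rtrans v c : dual H))).
Definition transG X c : H2 :=
  twisted_galois_l C (\sw_(u, v <- X) (theta_tr (rtrans u c) \ox v)).

Lemma transF_linear c : linear (transF^~ c).
Proof. by rewrite /transF; apply: lin_comp; [exact: twisted_galois_r_linear | lin]. Qed.
Lemma transG_linear c : linear (transG^~ c).
Proof. by rewrite /transG; apply: lin_comp; [exact: twisted_galois_l_linear | lin]. Qed.

Lemma transFE u v c :
  transF (u \ox v) c = twisted_galois_r C (u \ox theta T (rtrans v c : dual H)).
Proof.
rewrite /transF sweedlerE //; split=> *; last by lin.
by apply: lin_purer; apply: (lin_comp lth (lrt c)).
Qed.
Lemma transGE u v c :
  transG (u \ox v) c = twisted_galois_l C (theta_tr (rtrans u c) \ox v).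
Proof.
rewrite /transG sweedlerE //; split=> *; first by lin.
by apply: lin_purel; apply: (lin_comp lth' (lrt c)).
Qed.

(** Associativity groups the product [f (c' g')] of [twdual_braiding] as
    [(f g'') c'']; its value at [x] is then a pairing with [C Delta(x)], in
    which [c''] and the last factor of [R_C] combine into [theta]. *)
Lemma azumayaF_transpose (t : tens A A) (c : A) x :
  ev (azumayaF R t c : A) x
  = \sw_(f, g <- t) tpair (transF (C * coprod x) c) f g.
Proof.
rewrite azumayaFE (sweedler_comp (h := fun u : A => ev u x)); last exact: ev_linearl.
apply: eq_sweedler => f g.
have -> : \sw_(r1, r2 <- R) (f * hact r2 c * hact r1 g)
        = f * \sw_(r1, r2 <- R) (hact r2 c * hact r1 g : A) :> A.
  rewrite (sweedler_comp (h := fun u : A => f * u)); last by lin.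
  by apply: eq_sweedler => r1 r2; rewrite mulrA.
rewrite twdual_braiding (sweedler_comp (h := fun u : A => f * u)); last by lin.
rewrite (sweedler_comp (h := fun u : A => ev u x)); last exact: ev_linearl.
transitivity (\sw_(s1, s2 <- T)
    tpair (C * coprod x) (f * (ltrans s1 g : A) : A) (ltrans s2 c)).
  by apply: eq_sweedler => s1 s2; rewrite mulrA twdual_evM.
move: (C * coprod x); apply: tens_ext => [||p q].
- apply: lin_in_sw => *; exact: tpair_linear.
- apply: (lin_comp (g := fun t => tpair t f g)); first exact: tpair_linear.
  exact: transF_linear.
rewrite transFE /twisted_galois_r sweedlerE; last by lin.
rewrite tpair_ltrans ltrans1 /theta.
rewrite (sweedler_comp (h := fun h => tpair (C * coprod p) f (ltrans h g))); last first.
  by apply: (lin_comp (g := tpair (C * coprod p) f)); [exact: tpair_lfr | exact: ltrans_linear].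
apply: eq_sweedler => s1 s2.
rewrite tpairE ltransE (twdual_evM f (ltrans s1 g)) rtransE ltransZ tpair_Zr.
exact: mulrC.
Qed.

Lemma azumayaG_transpose (t : tens A A) (c : A) x :
  ev (azumayaG R t c : A) x
  = \sw_(f, g <- t) tpair (transG (C * coprod x) c) f g.
Proof.
rewrite azumayaGE (sweedler_comp (h := fun u : A => ev u x)); last exact: ev_linearl.
apply: eq_sweedler => f g.
have -> : \sw_(r1, r2 <- R) (hact r2 f * hact r1 c * g)
        = (\sw_(r1, r2 <- R) (hact r2 f * hact r1 c : A)) * g :> A.
  by rewrite (sweedler_comp (h := fun u : A => u * g)) //; lin.
rewrite twdual_braiding (sweedler_comp (h := fun u : A => u * g)); last by lin.
rewrite (sweedler_comp (h := fun u : A => ev u x)); last exact: ev_linearl.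
transitivity (\sw_(s1, s2 <- T)
    tpair (C * coprod x) (ltrans s1 c) ((ltrans s2 f : A) * g : A)).
  by apply: eq_sweedler => s1 s2; rewrite -mulrA twdual_evM.
move: (C * coprod x); apply: tens_ext => [||p q].
- apply: lin_in_sw => *; exact: tpair_linear.
- apply: (lin_comp (g := fun t => tpair t f g)); first exact: tpair_linear.
  exact: transG_linear.
rewrite transGE /twisted_galois_l sweedlerE; last by lin.
rewrite tpair_ltrans ltrans1 /theta_tr.
rewrite (sweedler_comp (h := fun h => tpair (C * coprod q) (ltrans h f) g)); last first.
  by apply: (lin_comp (g := fun u => tpair (C * coprod q) u g));
    [exact: tpair_lfl | exact: ltrans_linear].
apply: eq_sweedler => s1 s2.
rewrite tpairE ltransE (twdual_evM (ltrans s2 f) g) rtransE ltransZ tpair_Zl.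
by [].
Qed.

Lemma transF_shift X y c : transF (X * (1 \ox y)) c = transF X (rtrans y c).
Proof.
move: X; apply: tens_ext => [||u v].
- by apply: (lin_comp (transF_linear c)); lin.
- exact: transF_linear.
by rewrite pureM mulr1 !transFE rtransM.
Qed.
Lemma transG_shift X y c : transG (X * (y \ox 1)) c = transG X (rtrans y c).
Proof.
move: X; apply: tens_ext => [||u v].
- by apply: (lin_comp (transG_linear c)); lin.
- exact: transG_linear.
by rewrite pureM mulr1 !transGE rtransM.
Qed.

Lemma theta_transpose f c : ev f (theta T (c : dual H)) = ev c (theta_tr f).
Proof.
rewrite /theta /theta_tr (sweedler_comp (h := ev f)); last exact: ev_linear.
rewrite (sweedler_comp (h := ev c)); last exact: ev_linear.
apply: eq_sweedler => s1 s2.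
by rewrite [LHS]linearZ_LR [RHS]linearZ_LR -[LHS]/(_ * _) -[RHS]/(_ * _) mulrC.
Qed.

Lemma theta_tr_surj : bijective (theta T) -> forall y, exists c, theta_tr c = y.
Proof.
case=> th' _ thK y.
have [g _ gK] : bijective theta_tr.
  apply: inj_linear_bij => //; first exact: dim_dual.
  apply: inj_linear => // f f0; apply/lfunP => x.
  rewrite -[LHS]/(ev f x) -(thK x) theta_transpose f0 lfunE.
  by apply: linear0_; apply: ev_linear.
by exists (g y).
Qed.

Lemma galois_surj X : exists t, X = C * galois t.
Proof.
have [g _ gK] : bijective (@galois k H).
  apply: inj_linear_bij => //; last exact: galois_inj.
  by rewrite /galois; lin.
by exists (g (C^-1 * X)); rewrite gK mulrA (twistK hT) mul1r.
Qed.
Lemma galois_l_surj X : exists t, X = C * galois_l t.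
Proof.
have [g _ gK] : bijective (@galois_l k H).
  apply: inj_linear_bij => //; last exact: (galois_l_inj (antipode_inj hR)).
  by rewrite /galois_l; lin.
by exists (g (C^-1 * X)); rewrite gK mulrA (twistK hT) mul1r.
Qed.

Definition pairing (t : tens A A) (p : H2) : k^o := \sw_(f, g <- t) tpair p f g.
Lemma pairing_linear (t : tens A A) : linear (pairing t).
Proof. by apply: lin_in_sw => *; exact: tpair_linear. Qed.

(** As the elements [C Delta(x) (1 (x) y)] span H (x) H, [transF_shift] extends
    the hypothesis from the [C Delta(x)] to all tensors. *)
Lemma transF_vanish (t : tens A A) :
  (forall c x, pairing t (transF (C * coprod x) c) = 0) ->
  forall X c, pairing t (transF X c) = 0.
Proof.
move=> t0 X c; have [s ->] := galois_surj X.
have l : linear (fun s => pairing t (transF (C * galois s) c)).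
  apply: (lin_comp (pairing_linear t)); apply: (lin_comp (transF_linear c)).
  by rewrite /galois; lin.
move: s; apply: tens_ext => [||x y]; [exact: l | exact: lin_0 |].
by rewrite galoisE mulrA transF_shift t0.
Qed.
Lemma transG_vanish (t : tens A A) :
  (forall c x, pairing t (transG (C * coprod x) c) = 0) ->
  forall X c, pairing t (transG X c) = 0.
Proof.
move=> t0 X c; have [s ->] := galois_l_surj X.
have l : linear (fun s => pairing t (transG (C * galois_l s) c)).
  apply: (lin_comp (pairing_linear t)); apply: (lin_comp (transG_linear c)).
  by rewrite /galois_l; lin.
move: s; apply: tens_ext => [||x y]; [exact: l | exact: lin_0 |].
rewrite /galois_l sweedlerE; last by lin.
by rewrite mulrA transG_shift t0.
Qed.

Lemma dim_end : \dim {:tens A A} = \dim {:'End(A)}.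
Proof. exact: etrans (dim_tens A A) (esym (dim_hom A A)). Qed.

Lemma azumayaF_linear : linear (@azumayaF k H R A).
Proof.
move=> d s t; apply/lfunP => c; rewrite azumayaFE linearP /=.
by rewrite lfunE /= lfunE /= !azumayaFE.
Qed.
Lemma azumayaG_linear : linear (@azumayaG k H R A).
Proof.
move=> d s t; apply/lfunP => c; rewrite azumayaGE linearP /=.
by rewrite lfunE /= lfunE /= !azumayaGE.
Qed.

(** If [F' t = 0] then [t] is orthogonal to every [transF X c], in particular
    to [transF (u (x) 1) c = twisted_galois_r C (u (x) theta c)]; as [theta]
    and [twisted_galois_r C] are surjective, [t = 0]. *)
Lemma theta_azumayaF : bijective (theta T) -> bijective (@azumayaF k H R A).
Proof.
case=> th _ thK; apply: inj_linear_bij; [exact: azumayaF_linear | exact: dim_end |].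
apply: inj_linear; first exact: azumayaF_linear.
move=> t t0; apply: tens_pair_sep => p.
have [g _ gK] : bijective (twisted_galois_r C).
  apply: inj_linear_bij => //; first exact: twisted_galois_r_linear.
  exact: (twisted_galois_r_inj hT (antipode_inj hR)).
rewrite -(gK p); move: (g p); apply: tens_ext => [||u h].
- by apply: (lin_comp (pairing_linear t)); exact: twisted_galois_r_linear.
- exact: lin_0.
have := @transF_vanish t _ (u \ox 1) (th h); rewrite transFE rtrans1 thK; apply.
move=> c x; rewrite /pairing -azumayaF_transpose t0 lfunE.
exact: (linear0_ (ev_linearl x)).
Qed.

Lemma theta_azumayaG : bijective (theta T) -> bijective (@azumayaG k H R A).
Proof.
move=> bth; apply: inj_linear_bij; [exact: azumayaG_linear | exact: dim_end |].
apply: inj_linear; first exact: azumayaG_linear.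
move=> t t0; apply: tens_pair_sep => p.
have [g _ gK] : bijective (twisted_galois_l C).
  apply: inj_linear_bij => //; first exact: twisted_galois_l_linear.
  exact: (twisted_galois_l_inj hT).
rewrite -(gK p); move: (g p); apply: tens_ext => [||h u].
- by apply: (lin_comp (pairing_linear t)); exact: twisted_galois_l_linear.
- exact: lin_0.
have [c0 <-] := theta_tr_surj bth h.
have := @transG_vanish t _ (1 \ox u) c0; rewrite transGE rtrans1; apply.
move=> c x; rewrite /pairing -azumayaG_transpose t0 lfunE.
exact: (linear0_ (ev_linearl x)).
Qed.

(** Suppose [theta c0 = 0], and write [1 (x) 1 = sum C Delta(x) (1 (x) y)]. Then
    [sum phi(y.c0)(x) = 0] for every [phi] in the image of [F'], because this is
    a pairing with [transF (1 (x) 1) c0 = twisted_galois_r C (1 (x) theta c0)].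
    When [F'] is surjective, taking [phi] of rank one gives
    [sum x (x) y.c0 = 0], whereas [sum x y = 1], so that [c0 = 0]. *)
Lemma azumayaF_theta : bijective (@azumayaF k H R A) -> bijective (theta T).
Proof.
case=> F' _ FK; apply: (@inj_linear_bij k (dual H) H) => //; first exact: dim_dual.
apply: (@inj_linear k (dual H) H) => // c0 c00.
have [s s1] := galois_surj 1.
pose Y : tens H (dual H) := \sw_(x, y <- s) (x \ox rtrans y c0).
have Y0 : Y = 0.
  apply: tens_sep => f n.
  pose phi : 'End(A) := linfun (fun c : A => (ev n c : k) *: (f : A)).
  have phiE c : phi c = (ev n c : k) *: (f : A).
    rewrite /phi linfun_linE // => d u v.
    by rewrite ev_linear scalerDl -scalerA.
  have e r : \sw_(x, y <- r) ev (phi (rtrans y c0) : A) x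
           = pairing (F' phi) (transF (C * galois r) c0).
    move: r; apply: tens_ext => [||x y].
    - exact: sweedler_linear.
    - apply: (lin_comp (pairing_linear _)); apply: (lin_comp (transF_linear c0)).
      by rewrite /galois; lin.
    rewrite galoisE mulrA transF_shift /pairing -azumayaF_transpose FK sweedlerE //.
    split=> u; first last.
      by apply: ev_linear.
    apply: (lin_comp (g := fun v : A => ev v u)); first exact: ev_linearl.
    by apply: lin_map; exact: rtrans_linear.
  transitivity (\sw_(x, y <- s) ev (phi (rtrans y c0) : A) x).
    rewrite /Y (sweedler_comp (h := fun t : tens H (dual H) =>
      \sw_(a, b <- t) (ev f a * ev n b))); last exact: sweedler_linear.
    apply: eq_sweedler => x y; rewrite sweedlerE; last first.
      by apply: mul_bil; exact: ev_linear.
    by rewrite phiE mulrC; apply: esym; apply: (@evZ k H _ f x).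
  rewrite e -s1 -[1]/(1 \ox 1) transFE rtrans1 c00.
  rewrite (linear0_ (pureDr 1)) (linear0_ (twisted_galois_r_linear C)).
  exact: (linear0_ (pairing_linear _)).
apply/lfunP => z; rewrite -[LHS]/(ev _ z) lfunE /=.
(* Apply the counit to the first factor of [1 (x) 1 = C galois(s)]. *)
have sxy : \sw_(x, y <- s) (x * y) = 1.
  transitivity (counit_l (C * galois s)); last by rewrite -s1 counit_l1.
  rewrite counit_lM (twist_counitl hT) mul1r.
  move: (s); apply: tens_ext => [||x y].
  - by lin.
  - by apply: lin_comp; [exact: counit_l_linear | rewrite /galois; lin].
  by rewrite galoisE counit_lM counitl_coprod counit_lE rmorph1 scale1r sweedlerE //; lin.
rewrite -[z]mulr1 -sxy (sweedler_comp (h := fun x => ev c0 (z * x))); last first.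
  by move=> d u v; rewrite mulrDr -scalerAr ev_linear.
pose Z (t : tens H (dual H)) : k^o := \sw_(x, c <- t) ev c (z * x).
suff -> : \sw_(x, y <- s) ev c0 (z * (x * y)) = Z Y by rewrite Y0 /Z linear0.
rewrite /Y (sweedler_comp (h := Z)); last exact: sweedler_linear.
apply: eq_sweedler => x y; rewrite /Z sweedlerE ?rtransE ?mulrA //.
split=> u; last by apply: (lin_comp (@ev_linear _ _ u)); lin.
exact: ev_linearl.
Qed.
End AzumayaTwisted.

Theorem corollary2p6 (k : fieldType) (H : hopfAlgType k) (R C : tens H H)
    (hR : is_Rmatrix R) (hC : is_2cocycle C) :
  azumaya R (twdual hC) <-> bijective (theta (twistR C R)).
Proof.
split=> [[bF _]|bth]; first exact: azumayaF_theta bF.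
by split; [exact: theta_azumayaF | exact: theta_azumayaG].
Qed.
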